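(* Let $p$ be a prime with $p\equiv -3\pmod 8$, let $s\ge 1$, $q=p^s$, and let $m\ge 2$ be an integer with $2^{m+1}\mid(q-1)$. Let $n\ge 1$ and let $N$ be the number of $(x_1,\dots,x_n)\in\mathbb F_q^n$ with $x_1^{2^m}+\dots+x_n^{2^m}=0$. For $r=1,2,\dots,m$ let $C_r,D_r$ be integers with $$p^{s/2^{r-1}}=C_r^2+D_r^2,\qquad C_r\equiv -1\pmod 4,\qquad p\nmid C_r.$$ Then \begin{align*} N=\,&q^{n-1}+\frac{q-1}{2^mq}\cdot\Bigl[2^{m-2}\cdot\Bigl((q^{\frac12}+2D_2q^{\frac14})^n+(q^{\frac12}-2D_2q^{\frac14})^n\Bigr)\\ &+\sum_{t=1}^{m-2}2^{m-t-2}\Bigl((-q^{\frac12}+\sum_{r=2}^t 2^{r-1}C_rq^{\frac{2^{r-1}-1}{2^{r}}}-2^t C_{t+1}q^{\frac{2^{t}-1}{2^{t+1}}}+2^{t+1} D_{t+2}q^{\frac{2^{t+1}-1}{2^{t+2}}})^n\\ &\qquad+(-q^{\frac12}+\sum_{r=2}^t 2^{r-1}C_rq^{\frac{2^{r-1}-1}{2^{r}}}-2^t C_{t+1}q^{\frac{2^{t}-1}{2^{t+1}}}-2^{t+1} D_{t+2}q^{\frac{2^{t+1}-1}{2^{t+2}}})^n\Bigr)\\ &+\Bigl(-q^{\frac 12}+\sum_{r=2}^{m-1}2^{r-1}C_r q^{\frac{2^{r-1}-1}{2^{r}}}-2^{m-1}C_m q^{\frac{2^{m-1}-1}{2^{m}}}\Bigr)^n\\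 &+\Bigl(-q^{\frac 12}+\sum_{r=2}^{m}2^{r-1}C_r q^{\frac{2^{r-1}-1}{2^{r}}}\Bigr)^n\Bigr]. \end{align*}
   Context: Powers $q^{a}$ with rational $a$ denote positive real powers. Empty sums are zero. Under the hypotheses, $2^{m-1}\mid s$, so $p^{s/2^{r-1}}$ is an integer for $r\le m$; the conditions determine $C_r$ uniquely and $D_r$ up to sign, and the formula holds for either choice of signs. *)

(* Defs.v *)
From HB Require Import structures.
From mathcomp Require Import all_boot all_order all_algebra all_field.
From mathcomp Require Import reals exp.
Set Implicit Arguments. Unset Strict Implicit. Unset Printing Implicit Defensive.
Import Order.TTheory GRing.Theory Num.Theory.
Local Open Scope ring_scope.

Definition qpow (R : realType) (q : nat) (num den : nat) : R :=
  powR (q%:R) (num%:R / den%:R).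

Definition Nsol (F : finFieldType) (n m : nat) : nat :=
  #|[set x : {ffun 'I_n -> F} | \sum_(i < n) x i ^+ (2 ^ m) == 0]|.

(* Main.v *)
Require Import Defs.
From HB Require Import structures.
From mathcomp Require Import all_boot all_order all_algebra all_field.
From mathcomp Require Import all_fingroup all_solvable.
From mathcomp Require Import reals exp complex.
From mathcomp Require Import zify ring.
Set Implicit Arguments. Unset Strict Implicit. Unset Printing Implicit Defensive.
Import Order.TTheory GRing.Theory Num.Theory.
Local Open Scope ring_scope.

(** Detecting zeros with an additive character [psi] reduces [N] to the sums
    [P k = sum_x psi (g ^ k x ^ (2 ^ m))], [k] modulo [2 ^ m], that is to Gaussian periods.
    Passing from [2 ^ (r - 1)]-th to [2 ^ r]-th powers splits every period in two; since [p]
    generates the residues [1] modulo [4] modulo [2 ^ r], Frobenius forces the two halves to be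
    equal unless [2 ^ (r - 2)] divides [k], so only two differences [c_r] and [d_r] remain at
    each level, and the Gauss sum of a character of order [2 ^ r] is [c_r + i d_r].

    The norm of a Gauss sum gives [c_r ^ 2 + d_r ^ 2 = q].  The duplication formula gives
    [(c_r + i d_r) ^ 2 = c_1 (c_(r-1) + i d_(r-1))] for [r >= 3], and
    [(c_2 + i d_2) ^ 2 = c_1 (u + i v)] with a quartic Jacobi sum [u + i v].  The latter is prime
    to [p], being a binomial coefficient without carries modulo a prime above [p]; hence
    [u = C_1] by uniqueness of primitive representations as a sum of two squares, and
    [C_r ^ 2 - D_r ^ 2 = - C_(r-1)] for the same reason.  This determines [c_r ^ 2] and
    [d_r ^ 2] inductively.  The signs of [c_r], [r < m], come from the fact that the period of
    the group of [2 ^ r]-th powers is an odd integer; the remaining signs do not affect the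
    sum. *)

(** * Sums of two squares *)

(** The relations among the [c r] and [d r] are quadratic, so the obstacle is signs, which can be
    fixed only where periods are rational integers. Since 4 is the exact power of 2 dividing
    [p - 1], the hypothesis [2 ^ m.+1 %| q - 1] makes every unit of the prime field a [2 ^ m.-1]-th
    power, and cosets modulo [2 ^ r]-th powers with [r < m] are stable under these units. It also
    makes [-1] and [4] into [2 ^ m]-th powers, which removes all character values from the norm and
    duplication formulas. The signs left open are those of [d r] and [c m]; each occurs only in a
    pair [(B + k x) ^ n], [(B - k x) ^ n].

    Characters take values in an arbitrary field [L]: complex conjugation becomes inversion of a
    root of unity, and reduction modulo a prime above [p] becomes a second evaluation of the quartic
    Jacobi sum, with values in [F] itself. Fractional powers are kept out until the end: the integer
    [a r = C r ^ 2 + D r ^ 2] stands for [p ^ (s / 2 ^ (r - 1))], and only [a 1 = p ^ s] and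
    [a (r + 1) ^ 2 = a r] are used of it. *)

Lemma int_oddP (a : int) : ~~ (2 %| a)%Z -> exists b, a = 2 * b + 1.
Proof. by move=> h; exists (a %/ 2)%Z; move: h; lia. Qed.

Lemma int_evenP (a : int) : (2 %| a)%Z -> exists b, a = 2 * b.
Proof. by move=> /dvdzP[b ->]; exists b; rewrite mulrC. Qed.

(** The product of [A = x y' - x' y] and [B = x y' + x' y] is [p ^ k (x ^ 2 - x' ^ 2)], and [p]
    cannot divide both because [A + B = 2 x y']; so [p ^ k] divides one of them. Brahmagupta's
    identity bounds the quotient [t] by [t ^ 2 <= 1], and [t] is even because the second coordinates
    are. *)
Lemma two_squares_unique (p k : nat) (x y x' y' : int) :
  prime p -> (0 < k)%N ->
  x ^+ 2 + y ^+ 2 = (p ^ k)%:Z -> x' ^+ 2 + y' ^+ 2 = (p ^ k)%:Z ->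
  ~~ (p%:Z %| x)%Z -> ~~ (p%:Z %| x')%Z ->
  ~~ (2 %| x)%Z -> ~~ (2 %| x')%Z -> ~~ (2 %| (p ^ k)%:Z)%Z -> x ^+ 2 = x' ^+ 2.
Proof.
move=> pp k0 e e' npx npx' ox ox' op.
have p2 : coprimez p%:Z 2.
  rewrite /coprimez /gcdz /=; apply/eqP; congr Posz; apply/eqP.
  rewrite -/(coprime p 2) coprime_sym prime_coprime //.
  apply/negP => h; move: op; rewrite dvdzE ; case/negP.
  by apply: (dvdn_trans h); rewrite dvdn_exp.
have pdvM (a b : int) : (p%:Z %| a * b)%Z = (p%:Z %| a)%Z || (p%:Z %| b)%Z.
  by rewrite !dvdzE abszM Euclid_dvdM.
have pdvX (a : int) : (p%:Z %| a ^+ 2)%Z = (p%:Z %| a)%Z.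
  by rewrite expr2 pdvM orbb.
have dvk : (p%:Z %| (p ^ k)%:Z)%Z by rewrite dvdzE dvdn_exp.
have ey' : ~~ (p%:Z %| y')%Z.
  apply/negP => h; case/negP: npx'; rewrite -pdvX.
  have -> : x' ^+ 2 = (p ^ k)%:Z - y' ^+ 2 by rewrite -e' addrK.
  by rewrite rpredB ?pdvX.
pose A := x * y' - x' * y; pose B := x * y' + x' * y.
have AB : A * B = (p ^ k)%:Z * (x ^+ 2 - x' ^+ 2).
  rewrite /A /B mulrBr -{1}e' -{1}e; ring.
have notboth : ~~ ((p%:Z %| A)%Z && (p%:Z %| B)%Z).
  apply/negP => /andP[hA hB].
  have : (p%:Z %| 2%:Z * (x * y'))%Z.
    have -> : 2%:Z * (x * y') = A + B by rewrite /A /B addrACA addNr addr0 (mulrDl 1 1) mul1r.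
    by rewrite rpredD.
  rewrite Gauss_dvdzr // pdvM (negPf npx) (negPf ey') //.
suff main (z w z' w' : int) : z ^+ 2 + w ^+ 2 = (p ^ k)%:Z ->
   z' ^+ 2 + w' ^+ 2 = (p ^ k)%:Z -> ~~ (2 %| z)%Z -> ~~ (2 %| z')%Z ->
   ((p ^ k)%:Z %| z * w' - z' * w)%Z -> z ^+ 2 = z' ^+ 2.
  have cop (a : int) : ~~ (p%:Z %| a)%Z -> coprimez (p ^ k)%:Z a.
    move=> h; rewrite /coprimez /gcdz /=; apply/eqP; congr Posz; apply/eqP.
    by rewrite -/(coprime _ _) coprimeXl // prime_coprime.
  have dAB : ((p ^ k)%:Z %| A * B)%Z by rewrite AB dvdz_mulr.
  move: notboth; rewrite negb_and => /orP[/cop hA|/cop hB].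
    (* Changing the sign of [y] exchanges the roles of [A] and [B]. *)
    apply: (main x (-y) x' y') => //; first by rewrite sqrrN.
    by rewrite mulrN opprK -/B -(Gauss_dvdzr B hA).
  by apply: (main x y x' y') => //; rewrite -/A -(Gauss_dvdzl A hB).
move=> {A B AB notboth e e' x y x' y' npx npx' ey' ox ox'} e e' ox ox' /dvdzP[t ht].
set q := (p ^ k)%:Z in e e' op ht.
have q0 : q != 0 by rewrite /q eqz_nat expn_eq0 -leqn0 leqNgt prime_gt0.
have id1 : (z * z' + w * w') ^+ 2 + (z * w' - z' * w) ^+ 2 = q ^+ 2.
  have -> : q ^+ 2 = (z ^+ 2 + w ^+ 2) * (z' ^+ 2 + w' ^+ 2) by rewrite e e' expr2.
  ring.
have id2 : (z * w' - z' * w) * (z * w' + z' * w) = q * (z ^+ 2 - z' ^+ 2).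
  rewrite mulrBr -{1}e' -{1}e; ring.
have ew (a b : int) : a ^+ 2 + b ^+ 2 = q -> ~~ (2 %| a)%Z -> (2 %| b)%Z.
  move=> h oa; apply/negP => ob.
  have [a' ea] := int_oddP oa; have [b' eb] := int_oddP (introN idP ob).
  case/negP: op; apply/dvdzP.
  exists (2 * a' ^+ 2 + 2 * a' + 2 * b' ^+2 + 2 * b' + 1).
  by rewrite -h ea eb; ring.
have [w1 hw1] := dvdzP (ew _ _ e ox).
have [w1' hw1'] := dvdzP (ew _ _ e' ox').
have t2 : (2 %| t * q)%Z.
  by rewrite -ht; apply/dvdzP; exists (z * w1' - z' * w1); rewrite hw1 hw1'; ring.
have t0 : t = 0.
  have tt : (z * z' + w * w') ^+ 2 = (1 - t ^+ 2) * q ^+ 2.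
    by apply: (addIr ((z * w' - z' * w) ^+ 2)); rewrite id1 ht; ring.
  have : (1 - t ^+ 2) >= 0.
    have : 0 <= (1 - t ^+ 2) * q ^+ 2 by rewrite -tt sqr_ge0.
    by rewrite pmulr_lge0 // exprn_gt0 // lt_def q0.
  move: t2; rewrite dvdzE abszM Euclid_dvdM //.
  move: op; rewrite dvdzE => /negPf ->; rewrite orbF.
  move=> h h2; have : t ^+ 2 <= 1 by rewrite -subr_ge0.
  have [a ->] : exists a, t = 2 * a by apply: int_evenP; rewrite dvdzE.
  rewrite exprMn; case: (eqVneq a 0) => [->|a0]; first by rewrite mulr0.
  have : 1 <= a ^+ 2 by rewrite -gtz0_ge1 exprn_even_gt0.
  by clear; set b := a ^+ 2; lia.
have : q * (z ^+ 2 - z' ^+ 2) = 0 by rewrite -id2 ht t0; ring.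
by move/eqP; rewrite mulf_eq0 (negPf q0) /= subr_eq0 => /eqP.
Qed.

Lemma mod4N1P (x : int) : (x = -1 %[mod 4])%Z -> exists y, x = 4 * y - 1.
Proof. by move=> h; exists ((x + 1) %/ 4)%Z; move: h; lia. Qed.

(** * Representations of the successive square roots of [p ^ s] as sums of two squares *)

Section TwoSquareTower.
Variables (p s m : nat) (C D : nat -> int).
Hypotheses (p_pr : prime p) (p5 : (p %% 8 = 5)%N) (s_gt0 : (0 < s)%N).
Notation a r := (C r ^+ 2 + D r ^+ 2).
Hypothesis a1 : a 1 = (p ^ s)%:Z.
Hypothesis aS : forall r, (0 < r < m)%N -> a r.+1 ^+ 2 = a r.
Hypothesis C_mod4 : forall r, (0 < r <= m)%N -> (C r = -1 %[mod 4])%Z.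
Hypothesis C_ndvd : forall r, (0 < r <= m)%N -> ~~ (p%:Z %| C r)%Z.

Let p_odd : odd p. Proof. by move: p5; clear; lia. Qed.

(** A nonnegative integer whose square is a power of [p] is itself a power of [p]. This brings every
    level within reach of [two_squares_unique]. *)
Lemma tower_pX r : (0 < r <= m)%N -> exists2 k, (0 < k)%N & a r = (p ^ k)%:Z.
Proof.
case: r => [|r] //; elim: r => [|r IH] rm; first by exists s.
have [k k0 e] := IH (ltnW rm).
have age0 : 0 <= a r.+2 by rewrite addr_ge0 ?sqr_ge0.
have h : a r.+2 ^+ 2 = (p ^ k)%:Z by rewrite -e aS.
case: (a r.+2) age0 h => // b _ h.
have hb : (b * b = p ^ k)%N by move: h; rewrite expr2 => -[].
have : (b %| p ^ k)%N by rewrite -hb dvdn_mulr.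
case/(dvdn_pfactor _ _ p_pr) => j _ bj; exists j; last by rewrite bj.
case: (posnP j) => // j0; move: hb; rewrite bj j0 => h1.
by have := ltn_exp2l 0 k (prime_gt1 p_pr); rewrite k0 -h1.
Qed.

Lemma tower_parity r : (0 < r <= m)%N -> exists y z, C r = 4 * y - 1 /\ D r = 2 * z.
Proof.
move=> rm; have [y yE] := mod4N1P (C_mod4 rm).
exists y; have [k k0 e] := tower_pX rm.
have op : ~~ (2 %| (p ^ k)%:Z)%Z by rewrite dvdzE /= dvdn2 oddX p_odd orbT.
have [z zE] : exists z, D r = 2 * z; last by exists z.
apply: int_evenP; apply: contraT => /int_oddP[z zE]; case/negP: op.
rewrite -e yE zE; apply/dvdzP; exists (8 * y ^+ 2 - 4 * y + 2 * z ^+ 2 + 2 * z + 1); ring.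
Qed.

Lemma tower_mod4 r : (0 < r <= m)%N -> exists y, a r = 4 * y + 1.
Proof.
move=> /tower_parity[y [z [-> ->]]]; exists (4 * y ^+ 2 - 2 * y + z ^+ 2); ring.
Qed.

(** The square of the Gaussian integer [C r + i D r] has norm [a r.-1] and real part prime to [p],
    so uniqueness gives [C r.-1] up to sign. As [C r] is odd and [D r] even, the left side is 1
    modulo 4 while [C r.-1] is -1; hence the minus sign. *)
Lemma tower_C r : (1 < r <= m)%N -> C r ^+ 2 - D r ^+ 2 = - C r.-1.
Proof.
case/andP; case: r => [|[|r]] //= _ rm.
have rm1 : (0 < r.+1 <= m)%N by exact: ltnW.
have [k k0 e] := tower_pX rm1; have [k' k0' e'] := tower_pX (r := r.+2) rm.
have [y [z [yE zE]]] := tower_parity (r := r.+2) rm.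
have [y' yE'] := mod4N1P (C_mod4 rm1).
have op j : ~~ (2 %| (p ^ j)%:Z)%Z by rewrite dvdzE /= dvdn2 oddX p_odd orbT.
have pd2 (t : int) : (p%:Z %| t ^+ 2)%Z = (p%:Z %| t)%Z.
  by rewrite expr2 !dvdzE abszM Euclid_dvdM // orbb.
have eqs : (C r.+2 ^+ 2 - D r.+2 ^+ 2) ^+ 2 = C r.+1 ^+ 2.
  apply: (@two_squares_unique p k _ (2 * C r.+2 * D r.+2) _ (D r.+1)) => //.
  - rewrite -e -aS //; ring.
  - apply/negP => h; case/negP: (C_ndvd (r := r.+2) rm); rewrite -pd2.
    have : (p%:Z %| 2%:Z * C r.+2 ^+ 2)%Z.
      have -> : 2%:Z * C r.+2 ^+ 2 = (C r.+2 ^+ 2 - D r.+2 ^+ 2) + a r.+2.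
        by rewrite (mulrDl 1 1) mul1r; ring.
      by rewrite rpredD // e' dvdzE dvdn_exp.
    rewrite Gauss_dvdzr // /coprimez /gcdz /=; apply/eqP; congr Posz; apply/eqP.
    by rewrite -/(coprime p 2) coprimen2 p_odd.
  - exact: C_ndvd.
  - apply/negP => /int_evenP[t]; rewrite yE zE => h.
    have : 2 * (8 * y ^+ 2 - 4 * y - 2 * z ^+ 2 - t) + 1 = (4 * y - 1) ^+ 2 - (2 * z) ^+ 2 - 2 * t.
      by ring.
    by rewrite h subrr; move: (_ - t); clear; lia.
  - by apply/negP => /int_evenP[t]; rewrite yE'; clear; lia.
move/eqP: eqs; rewrite -subr_eq0 subr_sqr mulf_eq0 subr_eq0 addr_eq0.
case/orP => /eqP // h; exfalso; move: h; rewrite yE zE yE' => h.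
have : 4 * (4 * y ^+ 2 - 2 * y - z ^+ 2 - y') + 2 = (4 * y - 1) ^+ 2 - (2 * z) ^+ 2 - (4 * y' - 1).
  by ring.
by rewrite h subrr; move: (_ - y'); clear; lia.
Qed.
End TwoSquareTower.

(** * Periodic sums *)

Section PeriodicSums.
Variable V : zmodType.
Implicit Types (h : nat -> V) (A B N : nat).

Lemma sum_residues h A B :
  \sum_(e < A * B) h e = \sum_(k < A) \sum_(e < B) h (k + A * e)%N.
Proof.
rewrite exchange_big /=; elim: B => [|B IH]; first by rewrite muln0 !big_ord0.
rewrite big_ord_recr /= -IH mulnS addnC big_split_ord /=; congr (_ + _).
by apply: eq_bigr => i _; rewrite addnC.
Qed.

Lemma sum_power_map h A B k : (forall e, h (e + A * B)%N = h e) ->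
  \sum_(e < A * B) h (k + A * e)%N = (\sum_(e < B) h (k + A * e)%N) *+ A.
Proof.
move=> per; rewrite mulnC (sum_residues (fun e => h (k + A * e)%N)).
rewrite -sumrMnl; apply: eq_bigr => i _.
rewrite (_ : _ *+ A = \sum_(j < A) h (k + A * i)%N); last by rewrite sumr_const card_ord.
apply: eq_bigr => -[j /= _] _.
elim: j => [|j IH]; first by rewrite muln0 addn0.
rewrite -[RHS]IH -[RHS]per; congr h; rewrite mulnS; nia.
Qed.

Lemma periodicM h N e j : (forall e, h (e + N)%N = h e) -> h (e + j * N)%N = h e.
Proof.
by move=> per; elim: j => [|j IH]; rewrite ?addn0 // mulSn addnCA addnC per IH.
Qed.

Lemma periodic_mod h N e : (forall e, h (e + N)%N = h e) -> h (e %% N)%N = h e.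
Proof. by move=> per; rewrite {2}(divn_eq e N) addnC periodicM. Qed.

Lemma sum_coprime_mul h N c : (0 < N)%N -> coprime c N ->
  (forall e, h (e + N)%N = h e) -> \sum_(e < N) h (c * e)%N = \sum_(e < N) h e.
Proof.
move=> N0 cop per.
pose f (e : 'I_N) : 'I_N := Ordinal (ltn_pmod (c * e) N0).
have f_inj : injective f.
  move=> [a ha] [b hb] /(congr1 val) /= /eqP; rewrite /f /=.
  move=> h'; apply: val_inj => /=.
  wlog le : a b ha hb h' / (a <= b)%N.
    move=> W; case: (leqP a b) => [|/ltnW] hab; first exact: W.
    by apply/esym; apply: W => //; rewrite eq_sym.
  move: h'; rewrite eq_sym eqn_mod_dvd ?leq_mul // -mulnBr Gauss_dvdr 1?coprime_sym //.
  case: (posnP (b - a)%N) => [|pos /(dvdn_leq pos)]; lia.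
rewrite [RHS](reindex f) /=; last by apply: onW_bij; exact: injF_bij.
by apply: eq_bigr => i _; rewrite periodic_mod.
Qed.
End PeriodicSums.

(** * Gauss and Jacobi sums *)

(** The values lie in an arbitrary field because the quartic Jacobi sum is needed both in
    characteristic 0 and in [F]. The trivial character also vanishes at 0. In [add_char] the zero
    sum expresses nontriviality. *)
Definition mult_char (F : finFieldType) (L : fieldType) (chi : F -> L) :=
  [/\ chi 0 = 0, chi 1 = 1 & {morph chi : x y / x * y}].
Definition add_char (F : finFieldType) (L : fieldType) (psi : F -> L) :=
  [/\ psi 0 = 1, {morph psi : x y / x + y >-> x * y} & \sum_x psi x = 0].
Definition gauss (F : finFieldType) (L : fieldType) (psi chi : F -> L) : L :=
  \sum_x chi x * psi x.
Definition jacobi (F : finFieldType) (L : fieldType) (chi phi : F -> L) : L :=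
  \sum_x chi x * phi (1 - x).

Section GaussJacobi.
Variables (F : finFieldType) (L : fieldType).
Implicit Types (chi phi psi : F -> L) (x y a : F).

Lemma sum_scale (h : F -> L) a : a != 0 -> \sum_x h (a * x) = \sum_x h x.
Proof.
move=> a0; rewrite [RHS](reindex (fun x => a * x)) //.
by apply: onW_bij; exists (fun x => a^-1 * x) => x; rewrite ?mulKf ?mulVKf.
Qed.

Lemma mult_char_sum0 chi a : mult_char chi -> a != 0 -> chi a != 1 -> \sum_x chi x = 0.
Proof.
move=> mc a0 ca; have [_ _ cM] := mc.
have : chi a * \sum_x chi x = \sum_x chi x.
  by rewrite mulr_sumr -[RHS](sum_scale _ a0); apply: eq_bigr => x _; rewrite cM.
move/eqP; rewrite -subr_eq0 -{2}[\sum_x _]mul1r -mulrBl mulf_eq0 subr_eq0 (negPf ca).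
by move/eqP.
Qed.

Lemma add_char_sum psi a : add_char psi ->
  \sum_x psi (a * x) = if a == 0 then #|F|%:R else 0.
Proof.
move=> [p0 _ s0]; case: eqP => [->|/eqP a0].
  rewrite (eq_bigr (fun=> 1)) => [|x _]; last by rewrite mul0r p0.
  by rewrite sumr_const.
by rewrite sum_scale.
Qed.

(** Collect the terms with [x + y = t]. For [t != 0] scaling by [t] extracts [chi t * phi t] and
    leaves the Jacobi sum; for [t = 0] the sum vanishes since [chi * phi] is nontrivial, as
    witnessed by [a]. *)
Lemma gaussM psi chi phi a : add_char psi -> mult_char chi -> mult_char phi ->
  a != 0 -> chi a * phi a != 1 ->
  gauss psi chi * gauss psi phi =
    gauss psi (fun x => chi x * phi x) * jacobi chi phi.
Proof.
move=> [_ pD s0] mc mp a0 ca; have [c0 c1 cM] := mc; have [p0 p1 pM] := mp.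
have mcp : mult_char (fun x => chi x * phi x).
  by split=> [||x y]; rewrite ?c0 ?mul0r ?c1 ?p1 ?mulr1 // cM pM mulrACA.
rewrite {1}/gauss big_distrl /=.
transitivity (\sum_t psi t * \sum_x chi x * phi (t - x)).
  under eq_bigr => x _ do rewrite /gauss big_distrr /=.
  under [RHS]eq_bigr => t _ do rewrite mulr_sumr.
  rewrite exchange_big [RHS]exchange_big /=.
  rewrite exchange_big /=; apply: eq_bigr => x _.
  rewrite [RHS](reindex (fun y => y + x)) /=; last first.
    by apply: onW_bij; exists (fun y => y - x) => y; rewrite ?addrK ?subrK.
  by apply: eq_bigr => y _; rewrite pD addrK; ring.
rewrite /gauss big_distrl /=; apply: eq_bigr => t _.
have [->|t0] := eqVneq t 0.
  rewrite c0 !mul0r -[RHS](mulr0 (psi 0)); congr (_ * _).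
  transitivity (phi (-1) * \sum_x chi x * phi x).
    by rewrite mulr_sumr; apply: eq_bigr => x _; rewrite sub0r -[- x]mulN1r pM mulrCA.
  by rewrite (mult_char_sum0 mcp a0) ?mulr0.
rewrite [RHS]mulrAC [RHS]mulrC; congr (_ * _).
rewrite -(sum_scale _ t0) /jacobi mulr_sumr.
by apply: eq_bigr => x _; rewrite -{2}[t]mulr1 -mulrBr cM pM; ring.
Qed.

(** After [y = x z] the sum over [x != 0] equals [#|F|] at [z = -1], zero elsewhere, minus 1
    throughout; the constant -1 contributes nothing because [phi] is nontrivial. *)
Lemma gauss_conj psi chi phi a : add_char psi -> mult_char chi -> mult_char phi ->
  a != 0 -> phi a != 1 ->
  (forall x, x != 0 -> chi x * phi x = 1) ->
  gauss psi chi * gauss psi phi = phi (-1) * #|F|%:R.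
Proof.
move=> ap mc mp a0 pa inv; have [c0 c1 cM] := mc; have [p0 p1 pM] := mp.
have [psi0 pD _] := ap.
rewrite {1}/gauss big_distrl /=.
transitivity (\sum_x \sum_z phi z * (if x == 0 then 0 else psi ((1 + z) * x))).
  apply: eq_bigr => x _; have [->|x0] := eqVneq x 0.
    by rewrite c0 !mul0r big1 // => z _; rewrite mulr0.
  rewrite /gauss -(sum_scale _ x0) mulr_sumr; apply: eq_bigr => z _.
  rewrite mulrDl mul1r pD pM [z * x]mulrC.
  transitivity (chi x * phi x * (phi z * (psi x * psi (x * z)))); first by ring.
  by rewrite inv ?mul1r.
rewrite exchange_big /=.
transitivity (\sum_z phi z * ((if 1 + z == 0 then #|F|%:R else 0) - 1)).
  apply: eq_bigr => z _; rewrite -mulr_sumr; congr (_ * _).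
  rewrite -(add_char_sum _ ap) // (bigD1 0) //= eqxx add0r.
  rewrite [in RHS](bigD1 0) //= mulr0 psi0 [RHS]addrAC subrr add0r.
  by apply: eq_bigr => x /negPf ->.
under eq_bigr => z _ do rewrite mulrBr mulr1.
rewrite sumrB (mult_char_sum0 mp a0 pa) subr0 (bigD1 (-1)) //= subrr eqxx big1 ?addr0 //.
by move=> z zN; rewrite addrC addr_eq0 (negPf zN) mulr0.
Qed.

(* Completing the square: [4 x (1 - x) = 1 - (2 x - 1) ^ 2]. *)
Lemma jacobi_diag chi eta a : mult_char chi -> a != 0 -> chi a != 1 -> (2 : F) != 0 ->
  (forall h : F -> L, \sum_y h (y ^+ 2) = \sum_z (1 + eta z) * h z) ->
  chi (2 ^+ 2) * jacobi chi chi = jacobi eta chi.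
Proof.
move=> mc a0 ca two0 sq; have [c0 c1 cM] := mc.
transitivity (\sum_y chi (1 - y ^+ 2)).
  rewrite [RHS](reindex (fun x => 2 * x - 1)) /=; last first.
    apply: onW_bij; exists (fun y => (y + 1) / 2) => y; rewrite ?subrK.
      by rewrite mulrC mulKf.
    by rewrite mulrC divfK // addrK.
  rewrite /jacobi mulr_sumr; apply: eq_bigr => x _.
  by rewrite -!cM; congr chi; ring.
(* In [1 + eta z] the constant 1 contributes the full sum of [chi], which is zero; [eta z] gives the
   Jacobi sum. *)
rewrite (sq (fun y => chi (1 - y))).
under eq_bigr => z _ do rewrite mulrDl mul1r.
rewrite big_split /= [X in X + _](_ : _ = 0) ?add0r //.
rewrite (reindex (fun x => 1 - x)) /=; last first.
  by apply: onW_bij; exists (fun y => 1 - y) => y; rewrite opprB addrC subrK.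
under eq_bigr => x _ do rewrite opprB addrC subrK.
exact: mult_char_sum0 mc a0 ca.
Qed.
End GaussJacobi.

Lemma finField_primitive_root (F : finFieldType) : exists g : F, #|F|.-1.-primitive_root g.
Proof.
have N0 : (0 < #|F|.-1)%N by rewrite -subn1 subn_gt0 finRing_gt1.
have : has (#|F|.-1).-primitive_root (enum (predC1 (0 : F))).
  apply: has_prim_root => //.
  - apply/allP => x; rewrite mem_enum inE => x0; rewrite unity_rootE.
    rewrite -(inj_eq (mulfI x0)) mulr1 -exprS prednK ?expf_card //.
    exact: ltnW (finRing_gt1 _).
  - exact: enum_uniq.
  - by rewrite -cardE cardC1.
by case/hasP => g _ hg; exists g.
Qed.

(* Meaningful for [x != 0] only. *)
Definition dlog (F : finFieldType) (g x : F) : nat :=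
  find (fun e => g ^+ e == x) (iota 0 #|F|.-1).

Definition power_char (F : finFieldType) (L : fieldType) (g : F) (w : L) (x : F) : L :=
  if x == 0 then 0 else w ^+ dlog g x.

Section DiscreteLog.
Variables (F : finFieldType) (g : F).
Hypothesis g_prim : #|F|.-1.-primitive_root g.
Notation N := #|F|.-1.

Lemma prim_root_neq0 : g != 0.
Proof.
apply/eqP => g0; have := prim_expr_order g_prim.
rewrite g0 expr0n; case: (posnP N) => [e|_].
  by have := prim_order_gt0 g_prim; rewrite e.
by move/esym/eqP; rewrite oner_eq0.
Qed.

Lemma finField_expN (x : F) : x != 0 -> x ^+ N = 1.
Proof.
move=> x0; apply: (mulfI x0); rewrite mulr1 -exprS prednK ?expf_card //.
exact: ltnW (finRing_gt1 _).
Qed.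

Lemma dlogK (x : F) : x != 0 -> g ^+ dlog g x = x.
Proof.
move=> /finField_expN /(prim_rootP g_prim)[i xi].
have h : has (fun e => g ^+ e == x) (iota 0 N).
  by apply/hasP; exists (val i); rewrite ?mem_iota /= ?xi.
have := nth_find 0%N h; rewrite -/(dlog g x) nth_iota; first by move/eqP.
by move: h; rewrite has_find size_iota.
Qed.

Lemma sum_finField (V : zmodType) (h : F -> V) :
  \sum_x h x = h 0 + \sum_(e < N) h (g ^+ e).
Proof.
rewrite (bigD1 0) //=; congr (_ + _).
pose f (e : 'I_N) := g ^+ e.
rewrite (reindex_onto f (fun x => Ordinal (ltn_pmod (dlog g x) (prim_order_gt0 g_prim)))) /=.
  apply: eq_big => [i|//]; rewrite /f expf_neq0 ?prim_root_neq0 //=.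
  apply/eqP/val_inj => /=.
  apply/eqP; rewrite -{2}(modn_small (ltn_ord i)) -(eq_prim_root_expr g_prim).
  by rewrite dlogK // expf_neq0 ?prim_root_neq0.
by move=> x x0; rewrite /f /= (prim_expr_mod g_prim) dlogK.
Qed.

Variable L : fieldType.

Lemma power_char_exp (w : L) e : w ^+ N = 1 -> power_char g w (g ^+ e) = w ^+ e.
Proof.
move=> wN; have g0 : g ^+ e != 0 by rewrite expf_neq0 ?prim_root_neq0.
rewrite /power_char (negPf g0) -[LHS](expr_mod _ wN) -[RHS](expr_mod _ wN); congr (_ ^+ _).
by apply/eqP; rewrite -(eq_prim_root_expr g_prim) dlogK.
Qed.

Lemma power_char_mult (w : L) : w ^+ N = 1 -> mult_char (power_char g w).
Proof.
move=> wN; split=> [||x y]; first by rewrite /power_char eqxx.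
  by rewrite -(expr0 g) power_char_exp.
have [->|x0] := eqVneq x 0; first by rewrite mul0r /power_char eqxx mul0r.
have [->|y0] := eqVneq y 0; first by rewrite mulr0 /power_char eqxx mulr0.
by rewrite -{1}(dlogK x0) -{1}(dlogK y0) -exprD power_char_exp // exprD /power_char
  (negPf x0) (negPf y0).
Qed.

Lemma power_charM (w z : L) x : power_char g w x * power_char g z x = power_char g (w * z) x.
Proof. by rewrite /power_char; case: eqP => _; rewrite ?mulr0 // exprMn. Qed.

Lemma gauss_power_char (psi : F -> L) (w : L) : w ^+ N = 1 ->
  gauss psi (power_char g w) = \sum_(e < N) w ^+ e * psi (g ^+ e).
Proof.
move=> wN; rewrite /gauss sum_finField /power_char eqxx mul0r add0r.
by apply: eq_bigr => e _; rewrite -/(power_char g w _) power_char_exp.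
Qed.

Lemma sum_powers (V : zmodType) (h : F -> V) A B a : (A * B)%N = N ->
  \sum_x h (g ^+ a * x ^+ A) = h 0 + (\sum_(e < B) h (g ^+ (a + A * e))) *+ A.
Proof.
move=> AB; have A0 : (0 < A)%N.
  by have := prim_order_gt0 g_prim; rewrite -AB muln_gt0 => /andP[].
rewrite sum_finField expr0n eqn0Ngt A0 mulr0; congr (_ + _).
rewrite -(sum_power_map (h := fun e => h (g ^+ e))) ?AB.
  by apply: eq_bigr => e _; rewrite exprD mulnC exprM.
by move=> e; rewrite exprD (prim_expr_order g_prim) mulr1.
Qed.

(** The weight counts square roots: with [eta] the quadratic character, [z] has [1 + eta z] of them,
    including the single root of 0. *)
Lemma sum_squares (h : F -> L) : ~~ odd N ->
  \sum_y h (y ^+ 2) = \sum_z (1 + power_char g (-1) z) * h z.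
Proof.
move=> eN; have [K eN2] : exists K, (2 * K)%N = N by exists N./2; rewrite mul2n even_halfK.
have m1 : (-1 : L) ^+ N = 1 by rewrite -signr_odd (negPf eN).
transitivity (\sum_y h (g ^+ 0 * y ^+ 2)).
  by apply: eq_bigr => y _; rewrite mul1r.
rewrite (sum_powers _ _ eN2) sum_finField {1}/power_char eqxx addr0 mul1r; congr (_ + _).
have := sum_residues (fun e => (1 + power_char g (-1) (g ^+ e)) * h (g ^+ e)) 2 K.
rewrite eN2 => ->.
rewrite big_ord_recl big_ord1 /= [X in _ + X]big1 ?addr0; last first.
  by move=> e _; rewrite power_char_exp // exprD exprM sqrrN expr1n expr1n expr1 mulr1 subrr mul0r.
rewrite -sumrMnl; apply: eq_bigr => e _.
by rewrite power_char_exp // add0n [(-1) ^+ _]exprM sqrrN expr1n expr1n mulr2n mulrDl mul1r.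
Qed.
End DiscreteLog.

(** * The trace and its character *)

Definition ftrace (F : finFieldType) (p s : nat) (x : F) : F := \sum_(i < s) x ^+ (p ^ i).

(* The residue represented by an element of the prime field; [p] elsewhere. *)
Definition prime_rep (F : finFieldType) (p : nat) (z : F) : nat :=
  index z [seq (i%:R : F) | i <- iota 0 p].

Definition trace_char (F : finFieldType) (L : fieldType) (p s : nat) (zeta : L) (x : F) : L :=
  zeta ^+ prime_rep p (ftrace p s x).

Section Trace.
Variables (F : finFieldType) (p s : nat).
Hypotheses (p_pr : prime p) (cardF : #|F| = (p ^ s)%N).
Implicit Types x y z c : F.

Let p_pchar : p \in [pchar F]. Proof. exact: card_finPcharP cardF p_pr. Qed.
Let pchar_exp i : [pchar F].-nat (p ^ i)%N.
Proof. by rewrite (eq_pnat _ (pcharf_eq p_pchar)) pnatX pnat_id. Qed.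

Lemma card_exp_gt0 : (0 < s)%N.
Proof. by case: s cardF => // c1; have := finRing_gt1 F; rewrite c1. Qed.

Lemma natr_mod_eq a b : (a%:R == b%:R :> F) = (a == b %[mod p])%N.
Proof.
wlog le : a b / (a <= b)%N.
  move=> W; case: (leqP a b) => [|/ltnW] h; first exact: W.
  by rewrite eq_sym W // eq_sym.
by rewrite eq_sym [RHS]eq_sym eqn_mod_dvd // (dvdn_pcharf p_pchar) natrB // subr_eq0.
Qed.

Lemma frobD i : {morph (fun x => x ^+ (p ^ i)) : x y / x + y}.
Proof. by move=> x y; rewrite exprDn_pchar. Qed.

Lemma ftraceD : {morph @ftrace F p s : x y / x + y}.
Proof. by move=> x y; rewrite /ftrace -big_split; apply: eq_bigr => i _; exact: frobD. Qed.

Lemma frob_order x : x ^+ (p ^ s) = x.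
Proof. by rewrite -cardF expf_card. Qed.

Lemma ftrace_frob x : ftrace p s (x ^+ p) = ftrace p s x.
Proof.
rewrite /ftrace; case: s card_exp_gt0 cardF => // k _ c.
rewrite big_ord_recr [RHS]big_ord_recl /= expn0 expr1 addrC; congr (_ + _).
  by rewrite -exprM -expnS -c expf_card.
by apply: eq_bigr => i _; rewrite -exprM -expnS.
Qed.

Lemma ftrace_fix x : ftrace p s x ^+ p = ftrace p s x.
Proof.
rewrite -[in RHS]ftrace_frob /ftrace.
transitivity (\sum_(i < s) (x ^+ (p ^ i)) ^+ p).
  have h := frobD 1; rewrite expn1 in h.
  by elim/big_rec2: _ => [|i a b _ <-]; rewrite ?h // expr0n -leqn0 leqNgt prime_gt0.
by apply: eq_bigr => i _; rewrite -!exprM mulnC.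
Qed.

Lemma frob_fixX c i : c ^+ p = c -> c ^+ (p ^ i) = c.
Proof. by move=> h; elim: i => [|i IH]; rewrite ?expr1 // expnSr exprM IH. Qed.

Lemma ftraceZ c x : c ^+ p = c -> ftrace p s (c * x) = c * ftrace p s x.
Proof.
move=> h; rewrite /ftrace mulr_sumr; apply: eq_bigr => i _.
by rewrite exprMn (frob_fixX _ h).
Qed.

Lemma prime_subfieldP z : z ^+ p = z -> exists2 t, (t < p)%N & z = t%:R.
Proof.
move=> zp; have [->|z0] := eqVneq z 0; first by exists 0%N; rewrite ?prime_gt0.
pose rs : seq F := [seq i%:R | i <- iota 1 p.-1].
have p0 := prime_gt0 p_pr; have p1 := prime_gt1 p_pr.
have nat_p (t : nat) : (t%:R : F) ^+ p = t%:R.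
  elim: t => [|t IH]; first by rewrite expr0n -leqn0 leqNgt p0.
  by have := frobD 1 t%:R 1; rewrite expn1 /= expr1n IH natr1.
have nz (t : nat) : (0 < t < p)%N -> (t%:R : F) != 0.
  case/andP=> t0 tp; rewrite -(dvdn_pcharf p_pchar); apply/negP => /(dvdn_leq t0).
  by rewrite leqNgt tp.
have unity x : x != 0 -> x ^+ p = x -> p.-1.-unity_root x.
  by move=> x0 xp; rewrite unity_rootE -(inj_eq (mulfI x0)) mulr1 -exprS prednK // xp.
case zrs: (z \in rs).
  case/mapP: zrs => t; rewrite mem_iota => /andP[t1 t2] ->.
  by exists t => //; rewrite add1n prednK in t2.
have : (size (z :: rs) <= p.-1)%N.
  apply: max_unity_roots; first by rewrite -subn1 subn_gt0.
    rewrite /= unity //=; apply/allP => _ /mapP[t ht ->].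
    apply: unity => //; apply: nz; move: ht; rewrite mem_iota add1n prednK //.
  rewrite /= zrs /= map_inj_in_uniq ?iota_uniq // => a b ha hb.
  move/eqP; rewrite natr_mod_eq.
  move: ha hb; rewrite !mem_iota add1n prednK // => /andP[_ ha] /andP[_ hb].
  by rewrite !modn_small // => /eqP.
by rewrite /= size_map size_iota ltnn.
Qed.

Lemma prime_repP z : z ^+ p = z -> (prime_rep p z < p)%N /\ (prime_rep p z)%:R = z.
Proof.
move=> /prime_subfieldP[t tp zt].
have zin : z \in [seq (i%:R : F) | i <- iota 0 p].
  by apply/mapP; exists t; rewrite // mem_iota.
have h : (prime_rep p z < p)%N by have := zin; rewrite -index_mem size_map size_iota.
split=> //; have := nth_index 0 zin; rewrite (nth_map 0%N) ?size_iota // nth_iota //.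
Qed.

(* The number of elements of trace zero in the subfield of order [p ^ d] is less than its
   order, by comparison with the degree of the relative trace polynomial. *)
Lemma ftrace_nontrivial d : (d %| s)%N -> ~~ (p %| s %/ d)%N ->
  exists2 y : F, y ^+ (p ^ d) = y & ftrace p s y != 0.
Proof.
move=> ds nps; set k := (s %/ d)%N in nps.
have sE : s = (k * d)%N by rewrite /k divnK.
have d0 : (0 < d)%N by have := card_exp_gt0; rewrite sE muln_gt0 => /andP[].
have k0 : (k%:R : F) != 0 by rewrite -(dvdn_pcharf p_pchar).
(* On the subfield of order [p ^ d] the [s] conjugates are [d] conjugates repeated [k] times, and
   [k] is invertible modulo [p]. *)
have trE y : y ^+ (p ^ d) = y -> ftrace p s y = k%:R * \sum_(i < d) y ^+ (p ^ i).
  move=> hy; rewrite /ftrace sE mulnC.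
  rewrite (sum_residues (fun i => y ^+ (p ^ i))) mulr_sumr; apply: eq_bigr => i _.
  rewrite (eq_bigr (fun=> y ^+ (p ^ i))) ?sumr_const ?card_ord ?mulr_natl // => j _.
  rewrite expnD mulnC exprM expnM; congr (_ ^+ _).
  by elim: (nat_of_ord j) => [|e IH]; rewrite ?expr1 // expnSr exprM IH.
pose Q : {poly F} := \sum_(i < d) 'X^(p ^ i).
have QE y : Q.[y] = \sum_(i < d) y ^+ (p ^ i).
  by rewrite /Q horner_sum; apply: eq_bigr => i _; rewrite hornerXn.
have p1 := prime_gt1 p_pr; have p0 := prime_gt0 p_pr.
have sQ : (size Q <= (p ^ d.-1).+1)%N.
  apply: (leq_trans (size_sum _ _ _)); apply/bigmax_leqP => i _.
  by rewrite size_polyXn ltnS leq_exp2l // -ltnS prednK.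
have Q0 : Q != 0.
  apply/negP => /eqP /(congr1 (fun q : {poly F} => q`_1)); rewrite coef0 /Q coef_sum.
  rewrite (bigD1 (Ordinal d0)) //= coefXn expn0 eqxx big1 ?addr0.
    by move/eqP; rewrite oner_eq0.
  move=> i; rewrite -val_eqE /= => i0; rewrite coefXn.
  by rewrite -(expn0 p) eqn_exp2l // eq_sym (negPf i0).
have [g gP] := finField_primitive_root F.
have dv : ((p ^ d).-1 %| #|F|.-1)%N by rewrite cardF sE mulnC expnM dvdn_pred_predX.
set M := (#|F|.-1 %/ (p ^ d).-1)%N.
have ME : (M * (p ^ d).-1)%N = #|F|.-1 by rewrite /M divnK.
have M0 : (0 < M)%N by have := prim_order_gt0 gP; rewrite -ME muln_gt0 => /andP[].
have pd0 : (0 < p ^ d)%N by rewrite expn_gt0 p0.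
(* These are the [p ^ d] elements of the subfield; [Q] has degree at most [p ^ d.-1] and cannot
   vanish at all of them. *)
pose rs := 0 :: [seq g ^+ (M * j) | j <- iota 0 (p ^ d).-1].
have rsK y : y \in rs -> y ^+ (p ^ d) = y.
  rewrite inE => /orP[/eqP->|/mapP[j _ ->]].
    by rewrite expr0n eqn0Ngt pd0.
  rewrite -{1}(prednK pd0) exprS [X in _ * X](_ : _ = 1) ?mulr1 //.
  by rewrite -exprM mulnAC ME exprM (prim_expr_order gP) expr1n.
have rsu : uniq rs.
  rewrite /= map_inj_in_uniq ?iota_uniq ?andbT.
    by apply/mapP => -[j _ /esym/eqP]; rewrite expf_eq0 (negPf (prim_root_neq0 gP)) andbF.
  move=> a b; rewrite !mem_iota !add0n /= => ha hb /eqP.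
  rewrite (eq_prim_root_expr gP) -ME !modn_small ?ltn_pmul2l //.
  by rewrite eqn_pmul2l // => /eqP.
case: (boolP (all (root Q) rs)) => [al|].
  have := max_poly_roots Q0 al rsu.
  rewrite /= size_map size_iota prednK // => h.
  have := leq_trans h sQ; rewrite ltnS leq_exp2l //; case: (d) d0 => // ? _ /=.
  by rewrite ltnn.
case/allPn => y yrs ny; exists y; first exact: rsK.
by rewrite trE ?rsK // mulf_neq0 // -QE.
Qed.

Section Character.
Variables (L : fieldType) (zeta : L).
Hypothesis zeta_prim : p.-primitive_root zeta.
Notation psi := (@trace_char F L p s zeta).

Lemma trace_char_val x t : ftrace p s x = t%:R -> psi x = zeta ^+ t.
Proof.
move=> e; have [_ h] := prime_repP (ftrace_fix x).
apply/eqP; rewrite /trace_char (eq_prim_root_expr zeta_prim) -natr_mod_eq h.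
by rewrite e.
Qed.

Lemma trace_charD : {morph psi : x y / x + y >-> x * y}.
Proof.
move=> x y; rewrite -exprD; apply: trace_char_val.
have [_ hx] := prime_repP (ftrace_fix x); have [_ hy] := prime_repP (ftrace_fix y).
by rewrite natrD hx hy ftraceD.
Qed.

Lemma trace_char0 : psi 0 = 1.
Proof.
rewrite (@trace_char_val _ 0) // /ftrace big1 // => i _.
by rewrite expr0n expn_eq0 -leqn0 leqNgt prime_gt0.
Qed.

Lemma trace_char_frob x : psi (x ^+ p) = psi x.
Proof. by rewrite /trace_char ftrace_frob. Qed.

Lemma trace_char_neq1 x : ftrace p s x != 0 -> psi x != 1.
Proof.
move=> t0; have [hlt h] := prime_repP (ftrace_fix x).
rewrite /trace_char -(expr0 zeta) (eq_prim_root_expr zeta_prim) -natr_mod_eq h.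
exact: t0.
Qed.

Lemma trace_char_sum_subgroup (A : {set F}) y : y \in A -> {in A &, forall a b, a - b \in A} ->
  psi y != 1 -> \sum_(x in A) psi x = 0.
Proof.
move=> yA AB py.
have NA a : a \in A -> - a \in A by move=> aA; rewrite -[- a]sub0r -{1}(subrr a) !AB.
have AD x : (x + y \in A) = (x \in A).
  apply/idP/idP => h; last by rewrite -[y]opprK AB ?NA.
  by rewrite -(addrK y x) AB.
have : psi y * \sum_(x in A) psi x = \sum_(x in A) psi x.
  rewrite mulr_sumr [RHS](reindex (fun x => x + y)) /=; last first.
    by apply: onW_bij; exists (fun x => x - y) => x; rewrite ?addrK ?subrK.
  by apply: eq_big => [x|x _]; rewrite ?AD // trace_charD mulrC.
move/eqP; rewrite -subr_eq0 -{2}[\sum_(x in _) _]mul1r -mulrBl mulf_eq0 subr_eq0 (negPf py).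
by move/eqP.
Qed.

Lemma trace_char_add_char : add_char psi.
Proof.
split; [exact: trace_char0 | exact: trace_charD |].
have [|y _ hy] := @ftrace_nontrivial s (dvdnn s).
  by rewrite divnn card_exp_gt0 gtnNdvd // prime_gt1.
transitivity (\sum_(x in [set: F]) psi x).
  by apply: eq_bigl => x; rewrite inE.
by apply: (trace_char_sum_subgroup (y := y)) => [|a b _ _|]; rewrite ?inE ?trace_char_neq1.
Qed.
End Character.
End Trace.

(** * Integrality and parity of periods *)

Section Parity.
Variable T : finType.

Lemma odd_card_involution (A : {set T}) (f : T -> T) :
  (forall x, x \in A -> f x \in A) -> (forall x, x \in A -> f (f x) = x) ->
  odd #|A| = odd #|[set x in A | f x == x]|.
Proof.
have [k] := ubnP #|A|; elim: k => // k IH in A * => /ltnSE leA fA ff.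
case: (pickP [pred x in A | f x != x]) => [x /= /andP[xA fx]|none]; last first.
  congr (odd _); apply: eq_card => x; rewrite inE; case xA: (x \in A) => //=.
  by have := none x; rewrite /= xA /= => /negbFE ->.
pose B := A :\ x :\ f x.
have fxA : f x \in A :\ x by rewrite !inE fx fA.
have cA : #|A| = #|B|.+2.
  by rewrite (cardsD1 x A) xA (cardsD1 (f x) (A :\ x)) fxA.
have BA y : y \in B -> y \in A by rewrite !inE => /and3P[].
have fB y : y \in B -> f y \in B.
  rewrite !inE => /and3P[h1 h2 yA]; rewrite fA // andbT; apply/andP; split.
    by apply: contraNneq h2 => e; rewrite -(ff y yA) e ff.
  by apply: contraNneq h1 => e; rewrite -e ff.
have lt : (#|B| < k)%N by apply: leq_trans leA; rewrite cA.
rewrite cA /= negbK (IH B lt fB (fun y yB => ff y (BA y yB))).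
congr (odd _); apply: eq_card => y; rewrite !inE.
case: (eqVneq (f y) y) => fy; rewrite ?andbF // !andbT.
case yA: (y \in A); rewrite ?andbF //= ?andbT.
have yx : y != x by apply: contraNneq fx => <-; rewrite fy.
rewrite yx andbT; apply: contraNneq yx => e.
by rewrite -(ff x xA) -e fy.
Qed.

(** Orbits have 2-power length. In the induction [f] composed with itself is handled first, and [f]
    is an involution on its fixed points. *)
Lemma odd_card_fix (v : nat) (A : {set T}) (f : T -> T) :
  (forall x, x \in A -> f x \in A) -> (forall x, x \in A -> iter (2 ^ v) f x = x) ->
  odd #|A| = odd #|[set x in A | f x == x]|.
Proof.
elim: v A f => [|v IH] A f fA ff.
  congr (odd _); apply: eq_card => x; rewrite inE; case xA: (x \in A) => //=.
  by have /= -> := ff x xA; rewrite eqxx.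
rewrite (IH A (fun x => f (f x))).
- rewrite (@odd_card_involution _ f) => [|x|x].
  + congr (odd _); apply: eq_card => x; rewrite !inE -andbA; congr (_ && _).
    by case: (eqVneq (f x) x) => [e|]; rewrite ?andbF // !e eqxx.
  + by rewrite !inE => /andP[xA /eqP e]; rewrite fA // e eqxx.
  + by rewrite !inE => /andP[_ /eqP].
- by move=> x xA; rewrite !fA.
- move=> x xA; rewrite -[RHS](ff x xA) expnS mulnC iterM.
  by elim: (2 ^ v)%N => //= n ->.
Qed.
End Parity.

Section Integrality.
Variables (F : finFieldType) (p s : nat).
Hypotheses (p_pr : prime p) (cardF : #|F| = (p ^ s)%N).
Variables (L : fieldType) (zeta : L).
Hypothesis zeta_prim : p.-primitive_root zeta.
Hypothesis L_char0 : [pchar L] =i pred0.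
Notation psi := (@trace_char F L p s zeta).

(** * Sums over sets on which the units of the prime field act *)

Section Weighted.
Variables (T : finType) (A : {set T}) (tau : T -> F) (act : F -> T -> T).
Hypothesis tau_fix : forall x, tau x ^+ p = tau x.
Hypothesis act_inj : forall c, c != 0 -> injective (act c).
Hypothesis act_stable : forall c x, c ^+ p = c -> c != 0 -> x \in A -> act c x \in A.
Hypothesis tau_act : forall c x, c ^+ p = c -> tau (act c x) = c * tau x.

Lemma card_fibre c : c ^+ p = c -> c != 0 ->
  #|[set x in A | tau x == c]| = #|[set x in A | tau x == 1]|.
Proof.
move=> cp c0; apply/eqP; rewrite eqn_leq; apply/andP; split.
  have cVp : c^-1 ^+ p = c^-1 by rewrite exprVn cp.
  rewrite -(card_imset _ (act_inj (invr_neq0 c0))); apply: subset_leq_card.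
  apply/subsetP => _ /imsetP[x xA ->]; move: xA; rewrite !inE => /andP[xA /eqP e].
  by rewrite act_stable ?invr_neq0 //= tau_act // e mulVf.
rewrite -(card_imset _ (act_inj c0)); apply: subset_leq_card.
apply/subsetP => _ /imsetP[x xA ->]; move: xA; rewrite !inE => /andP[xA /eqP e].
by rewrite act_stable //= tau_act // e mulr1.
Qed.

(** The group action makes all fibres over nonzero values equally large. A general [h] serves two
    purposes: powers of [zeta] give the character sum, an integer because the nontrivial powers add
    up to -1, and the constant 1 gives the cardinality. *)
Lemma sum_fibres (V : zmodType) (h : nat -> V) :
  \sum_(x in A) h (prime_rep p (tau x)) =
  h 0%N *+ #|[set x in A | tau x == 0]| +
  (\sum_(t < p | t != 0 :> nat) h t) *+ #|[set x in A | tau x == 1]|.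
Proof.
have p0 := prime_gt0 p_pr.
pose o x : 'I_p := Ordinal (ltn_pmod (prime_rep p (tau x)) p0).
rewrite (partition_big o xpredT) //=.
have fib (t : 'I_p) : \sum_(x in A | o x == t) h (prime_rep p (tau x)) =
    h t *+ #|[set x in A | tau x == t%:R]|.
  rewrite -sumr_const; apply: eq_big => [x|x /andP[_ /eqP <-]]; last first.
    by have [hl _] := prime_repP p_pr cardF (tau_fix x); rewrite /= modn_small.
  rewrite inE; congr (_ && _); rewrite -val_eqE /=.
  have [hl hr] := prime_repP p_pr cardF (tau_fix x).
  by rewrite -{2}hr (natr_mod_eq p_pr cardF) (modn_small (ltn_ord t)).
rewrite (bigD1 (Ordinal p0)) //= fib /=; congr (_ + _).
rewrite -sumrMnl; apply: eq_big => [t|t t0]; first by rewrite -val_eqE.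
rewrite fib card_fibre //.
  have := frobD p_pr cardF 1; rewrite expn1 => fD.
  elim: (nat_of_ord t) => [|k IH]; first by rewrite expr0n -leqn0 leqNgt p0.
  by rewrite -natr1 fD IH expr1n.
rewrite -[0]/(0%:R) (natr_mod_eq p_pr cardF) (modn_small (ltn_ord t)) mod0n.
by rewrite -val_eqE in t0.
Qed.

Lemma weighted_sum_int :
  \sum_(x in A) zeta ^+ prime_rep p (tau x) =
  #|[set x in A | tau x == 0]|%:R - #|[set x in A | tau x == 1]|%:R.
Proof.
rewrite (sum_fibres (fun t => zeta ^+ t)) expr0 -mulNrn; congr (_ + _ *+ _).
have p0 := prime_gt0 p_pr.
have : (zeta - 1) * \sum_(t < p) zeta ^+ t = 0.
  by rewrite -subrX1 (prim_expr_order zeta_prim) subrr.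
move/eqP; rewrite mulf_eq0 subr_eq0 => /orP[/eqP z1|].
  have := eq_prim_root_expr zeta_prim 0 1; rewrite z1 !expr1n eqxx.
  by rewrite mod0n modn_small ?prime_gt1.
rewrite (bigD1 (Ordinal p0)) //= expr0 addr_eq0 => /eqP h.
rewrite (eq_bigl (fun i => i != Ordinal p0)) => [|t]; last by rewrite -val_eqE.
by apply/eqP; rewrite -eqr_oppLR -h.
Qed.

Lemma weighted_card :
  #|A| = (#|[set x in A | tau x == 0%R]| + p.-1 * #|[set x in A | tau x == 1%R]|)%N.
Proof.
have := sum_fibres (fun=> 1 : int); rewrite sumr_const => /eqP.
have -> : \sum_(t < p | t != 0 :> nat) (1 : int) = p.-1%:R.
  have p0 := prime_gt0 p_pr.
  have := card_ord p; rewrite -sum1_card (bigD1 (Ordinal p0)) //= => e.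
  rewrite -[in RHS]e add1n /= natr_sum; by apply: eq_big => [t|//]; rewrite -val_eqE.
by rewrite -mulrnA -natrD eqr_nat => /eqP.
Qed.
End Weighted.

Lemma trace_weighted_int (A : {set F}) :
  (forall c x, c ^+ p = c -> c != 0 -> x \in A -> c * x \in A) ->
  let n0 := #|[set x in A | ftrace p s x == 0]| in
  let n1 := #|[set x in A | ftrace p s x == 1]| in
  \sum_(x in A) psi x = n0%:R - n1%:R /\ #|A| = (n0 + p.-1 * n1)%N.
Proof.
move=> st; have act_inj (c : F) : c != 0 -> injective ( *%R c) by apply: mulfI.
have tf := ftrace_fix p_pr cardF.
have ta c x := @ftraceZ F p s c x.
split; first exact: (weighted_sum_int tf act_inj st ta).
exact: (weighted_card tf act_inj st ta).
Qed.

(** Only diagonal scaling is required, which covers symmetrised products of two periods that need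
    not be rational individually. *)
Lemma trace_pair_int (B : {set F * F}) :
  (forall c x, c ^+ p = c -> c != 0 -> x \in B -> (c * x.1, c * x.2) \in B) ->
  exists n : int, \sum_(x in B) psi x.1 * psi x.2 = n%:~R.
Proof.
move=> st; pose act (c : F) (x : F * F) := (c * x.1, c * x.2).
have act_inj (c : F) : c != 0 -> injective (act c).
  by move=> c0 [a b] [a' b'] [/(mulfI c0)-> /(mulfI c0)->].
pose tau (x : F * F) := ftrace p s (x.1 + x.2).
have tf x : tau x ^+ p = tau x by apply: (ftrace_fix p_pr cardF).
have ta c x : c ^+ p = c -> tau (act c x) = c * tau x.
  by move=> cp; rewrite /tau -ftraceZ // mulrDr.
have e := weighted_sum_int tf act_inj st ta.
exists (Posz #|[set x in B | tau x == 0]| - Posz #|[set x in B | tau x == 1]|).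
rewrite rmorphB /= -!pmulrn -e; apply: eq_bigr => x _.
by rewrite -(trace_charD p_pr cardF zeta_prim).
Qed.

Lemma natrL_inj a b : a%:R = b%:R :> L -> a = b.
Proof.
wlog le : a b / (a <= b)%N.
  by move=> W; case: (leqP a b) => [|/ltnW] h e; [exact: W | apply/esym; exact: W].
move/esym/eqP; rewrite -subr_eq0 -natrB // (proj1 (pcharf0P L) L_char0).
by rewrite subn_eq0 => le'; apply/eqP; rewrite eqn_leq le.
Qed.

Let p_odd_neq (y : F) : odd p -> - y = y -> y = 0.
Proof.
move=> po e; have : y *+ 2 = 0 by rewrite mulr2n -{1}e addNr.
move/eqP; rewrite -mulr_natl mulf_eq0 -(dvdn_pcharf (card_finPcharP cardF p_pr)).
rewrite gtnNdvd //=; first by move/eqP.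
by have := prime_gt1 p_pr; case: (p) po => [|[|[|]]].
Qed.

(* Over the subfield of order [p ^ d] the trace takes each value equally often, and
   Frobenius moves the remaining elements in orbits of even length. *)
Lemma odd_period (v d M : nat) : odd p -> s = (2 ^ v * d)%N -> (0 < M)%N -> ~~ odd M ->
  (p.-1 %| M)%N -> ((p ^ d).-1 %| M)%N ->
  exists2 E : int, \sum_(y in [set y : F | y ^+ M == 1]) psi y = E%:~R & ~~ (2 %| E)%Z.
Proof.
move=> po sE M0 eM pM dM; set A := [set y : F | _].
have p0 := prime_gt0 p_pr; have p1 := prime_gt1 p_pr.
have expM1 (k : nat) (c : F) : (0 < k)%N -> (k.-1 %| M)%N -> c ^+ k = c -> c != 0 -> c ^+ M = 1.
  move=> k0 /dvdnP[j ->] ck c0; rewrite mulnC exprM (_ : c ^+ k.-1 = 1) ?expr1n //.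
  by apply: (mulfI c0); rewrite -exprS prednK // mulr1.
have stA c x : c ^+ p = c -> c != 0 -> x \in A -> c * x \in A.
  by move=> cp c0; rewrite !inE exprMn (expM1 p c) // mul1r.
have [sA cA] := trace_weighted_int stA; rewrite /= in sA cA.
set n0 := #|_| in sA cA; set n1 := #|_| in sA cA.
have A0 : 0 \notin A by rewrite inE expr0n eqn0Ngt M0 eq_sym oner_eq0.
have evA : ~~ odd #|A|.
  rewrite (@odd_card_involution _ A -%R).
  - rewrite (_ : [set x in A | _] = set0) ?cards0 //; apply/setP => y.
    rewrite in_set0; apply/negP; rewrite !inE => /andP[yM /eqP /(p_odd_neq po) y0].
    by move: A0; rewrite inE -y0 yM.
  - by move=> y; rewrite !inE exprNn -signr_odd (negPf eM) mul1r.
  - by move=> y _; rewrite opprK.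
pose K := [set y : F | y ^+ (p ^ d) == y].
have KB : {in K &, forall a b, a - b \in K}.
  move=> a b; rewrite !inE => /eqP ha /eqP hb.
  apply/eqP; apply: (addIr b); rewrite subrK -{2}hb -(frobD p_pr cardF) subrK //.
have stK c x : c ^+ p = c -> c != 0 -> x \in K -> c * x \in K.
  by move=> cp c0; rewrite !inE exprMn (frob_fixX _ cp) => /eqP ->.
have [sK cK] := trace_weighted_int stK; rewrite /= in sK cK.
set m0 := #|_| in sK cK; set m1 := #|_| in sK cK.
have d0 : (0 < d)%N by have := card_exp_gt0 cardF; rewrite sE muln_gt0 => /andP[].
have [||y yK ty] := @ftrace_nontrivial F p s p_pr cardF d; first by rewrite sE dvdn_mull.
  rewrite sE mulnK // -prime_coprime // coprime_sym coprimeXl // coprime2n //.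
have K0 : \sum_(x in K) psi x = 0.
  apply: (trace_char_sum_subgroup p_pr cardF zeta_prim (y := y)) => //.
    by rewrite inE yK.
  exact: trace_char_neq1.
(* [psi] is nontrivial on the additive group [K], so its sum there is zero; consequently
   [#|K| = p * m1], and [m1] is odd with [#|K|]. *)
have m01 : m0 = m1 by apply: natrL_inj; apply/eqP; rewrite -subr_eq0 -sK K0.
have oddK : odd #|K|.
  rewrite (@odd_card_involution _ K -%R); last by move=> x _; rewrite opprK.
    rewrite (_ : [set x in K | _] = [set 0]) ?cards1 //.
    apply/setP => x; rewrite !inE; apply/andP/eqP => [[_ /eqP/(p_odd_neq po)] //|->].
    by rewrite oppr0 expr0n expn_eq0 -leqn0 leqNgt p0 eqxx.
  by move=> x xK; rewrite -[- x]sub0r -{1}(subrr x) !KB.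
have odm1 : odd m1.
  by move: oddK; rewrite cK m01 -mulSn prednK // oddM => /andP[].
(* The map [x -> x ^ (p ^ d)] has order dividing [2 ^ v] and preserves the elements of [A] of trace
   one. Its fixed points among them are exactly those counted by [m1], since the nonzero elements of
   [K] lie in [A]. *)
have odn1 : odd n1.
  rewrite /n1 (@odd_card_fix _ v _ (fun x => x ^+ (p ^ d))).
  - rewrite [X in odd X](_ : _ = m1) //; apply: eq_card => x; rewrite !inE.
    have [xK|] := eqVneq (x ^+ (p ^ d)) x; rewrite ?andbF //= andbT.
    case: (eqVneq (ftrace p s x) 1) => tx; rewrite ?andbF // andbT.
    rewrite (expM1 (p ^ d)%N x) ?eqxx ?expn_gt0 ?p0 //.
    apply/eqP => x0; move: tx; rewrite x0 /ftrace big1 => [/esym/eqP|i _].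
      by rewrite oner_eq0.
    by rewrite expr0n expn_eq0 -leqn0 leqNgt p0.
  - move=> x; rewrite !inE => /andP[/eqP xM /eqP tx].
    rewrite exprAC xM expr1n eqxx /=.
    elim: (d) => [|k IH]; first by rewrite expr1 tx.
    by rewrite expnSr exprM (ftrace_frob cardF).
  - move=> x _; have it k : iter k (fun x => x ^+ (p ^ d)) x = x ^+ (p ^ (d * k)).
      elim: k => [|k IH]; first by rewrite muln0 expr1.
      by rewrite iterS IH -exprM -expnD mulnS addnC.
    by rewrite it mulnC -sE (frob_order cardF).
exists (Posz n0 - Posz n1); first by rewrite rmorphB /= -!pmulrn.
have : ~~ odd n0.
  by move: evA; rewrite cA oddD oddM -subn1 oddB //= po /= addbF.
by move: odn1; clear; lia.
Qed.
End Integrality.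

(** * Gaussian periods *)

(** Sorting by 2-adic valuation is adapted to [power_sum], which depends only on the valuation of
    [k] and its odd part modulo 4. *)
Lemma sum_dyadic (V : zmodType) (h : nat -> V) m :
  \sum_(k < 2 ^ m) h k =
  \sum_(0 <= j < m) \sum_(i < 2 ^ (m - j.+1)) h (2 ^ j * (1 + 2 * i))%N + h 0%N.
Proof.
elim: m h => [|m IH] h; first by rewrite big_ord1 big_geq // add0r.
rewrite expnS sum_residues big_ord_recl big_ord1 /= addrC.
rewrite [X in _ + X](eq_bigr (fun e : 'I__ => h (2 * e)%N)) => [|e _ //].
rewrite (IH (fun e => h (2 * e)%N)) muln0 addrA; congr (_ + _).
rewrite big_nat_recl // subSS subn0; congr (_ + _).
  by apply: eq_bigr => i _; rewrite mul1n.
by apply: eq_bigr => j _; apply: eq_bigr => i _; rewrite mulnA -expnS.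
Qed.

(** The exact valuation [i + 2] is what [p = 5] modulo 8 provides: squaring [1 + 2 ^ i.+2 * u]
    raises the valuation by exactly one. So [p] generates the residues 1 modulo 4. *)
Lemma exp5_pow2 p i : (p %% 8 = 5)%N -> exists2 u, odd u & (p ^ (2 ^ i) = 1 + 2 ^ i.+2 * u)%N.
Proof.
move=> p8; elim: i => [|i [u ou e]].
  by exists (p %/ 4)%N; rewrite ?expn1; lia.
exists (u + 2 ^ i.+1 * u ^ 2)%N; first by rewrite oddD oddM oddX /= ou.
rewrite expnSr expnM e !expnS; set a := (2 ^ i)%N; lia.
Qed.

Section Periods.
Variables (L : fieldType) (f : nat -> L) (N m p : nat).
Hypotheses (N_gt0 : (0 < N)%N) (f_per : forall e, f (e + N)%N = f e) (dvd_N : (2 ^ m %| N)%N).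
Hypotheses (p5 : (p %% 8 = 5)%N) (cop_p : coprime p N) (f_frob : forall e, f (p * e)%N = f e).
Hypothesis f_sum : \sum_(e < N) f e = -1.

(* For [f e = psi (g ^ e)], [period r k] is the sum of [psi] over the coset of [g ^ k] modulo
   [2 ^ r]-th powers, and [power_sum r k] is [sum_x psi (g ^ k x ^ (2 ^ r))]. *)
Definition period r k : L := \sum_(e < N %/ 2 ^ r) f (k + 2 ^ r * e)%N.
Definition period_diff r k : L := period r k - period r (k + 2 ^ r.-1)%N.
Definition power_sum r k : L := 1 + 2 ^+ r * period r k.

Let divN r : (r <= m)%N -> (2 ^ r * (N %/ 2 ^ r))%N = N.
Proof. by move=> rm; rewrite mulnC divnK // (dvdn_trans _ dvd_N) // dvdn_exp2l. Qed.

Lemma period_shift r k : (r <= m)%N -> period r (k + 2 ^ r)%N = period r k.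
Proof.
move=> rm; have := divN rm; rewrite /period; set M := (N %/ _)%N.
case: M => [|M] MN; first by rewrite !big_ord0.
rewrite big_ord_recr [RHS]big_ord_recl /= muln0 addn0 addrC; congr (_ + _).
  by rewrite -addnA -mulnS MN f_per.
by apply: eq_bigr => i _; rewrite -addnA -mulnS.
Qed.

Lemma period_modn r k k' : (r <= m)%N -> (k = k' %[mod 2 ^ r])%N -> period r k = period r k'.
Proof.
move=> rm e; have ps e := period_shift e rm.
by rewrite -(periodic_mod (N := 2 ^ r) k) // e periodic_mod.
Qed.

Lemma period_split r k : (r < m)%N -> period r k = period r.+1 k + period r.+1 (k + 2 ^ r)%N.
Proof.
move=> rm; rewrite /period.
have -> : (N %/ 2 ^ r = 2 * (N %/ 2 ^ r.+1))%N.
  apply/eqP; rewrite -(eqn_pmul2l (expn_gt0 2 r)) mulnA -expnSr divN ?divN //; exact: ltnW.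
rewrite (sum_residues (fun e => f (k + 2 ^ r * e)%N)) big_ord_recl big_ord1 /=.
have e2 e : (2 ^ r.+1 * e = 2 ^ r * (2 * e))%N by rewrite expnSr mulnA.
congr (_ + _); apply: eq_bigr => e _; rewrite e2 ?add0n //.
by rewrite -addnA -mulnS.
Qed.

Lemma period_frob r k : (r <= m)%N -> period r (p * k)%N = period r k.
Proof.
move=> rm; have MN := divN rm; rewrite /period; set M := (N %/ _)%N in MN *.
transitivity (\sum_(e < M) f (p * k + 2 ^ r * (p * e))%N).
  rewrite (sum_coprime_mul (h := fun e => f (p * k + 2 ^ r * e)%N)) //.
  - by move: N_gt0; rewrite -MN muln_gt0 => /andP[].
  - by move: cop_p; rewrite -MN coprimeMr => /andP[].
  - by move=> e; rewrite mulnDr addnA MN f_per.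
by apply: eq_bigr => e _; rewrite -[RHS]f_frob; congr f; ring.
Qed.

Lemma period_frobX r k i : (r <= m)%N -> period r (p ^ i * k)%N = period r k.
Proof. by move=> rm; elim: i => [|i IH]; rewrite ?mul1n // expnS -mulnA period_frob. Qed.

Lemma period_diff_modn r k k' : (r <= m)%N -> (k = k' %[mod 2 ^ r])%N ->
  period_diff r k = period_diff r k'.
Proof.
move=> rm e; rewrite /period_diff (period_modn rm e); congr (_ - _).
by apply: period_modn => //; apply/eqP; rewrite eqn_modDr; apply/eqP.
Qed.

Lemma period_diff_half r k : (0 < r <= m)%N ->
  period_diff r (k + 2 ^ r.-1)%N = - period_diff r k.
Proof.
case/andP=> r0 rm; rewrite /period_diff opprB -addnA addnn -mul2n -expnS prednK //.
by rewrite period_shift.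
Qed.

(* Frobenius identifies the residues [k] and [k + 2 ^ r.-1] modulo [2 ^ r] here. *)
Lemma period_diff_eq0 r j t : (j.+2 < r <= m)%N -> odd t -> period_diff r (2 ^ j * t)%N = 0.
Proof.
case/andP=> jr rm ot; apply/eqP; rewrite subr_eq0; apply/eqP.
(* The exponent is chosen so that this power of [p] is [1 + 2 ^ (r - j - 1) * u]; multiplying
   [2 ^ j * t] by it adds an odd multiple of [2 ^ r.-1]. *)
have [u ou e] := exp5_pow2 (r - j.+3) p5.
rewrite -(period_frobX _ (2 ^ (r - j.+3)) rm) e.
apply: period_modn => //.
have -> : ((1 + 2 ^ (r - j.+3).+2 * u) * (2 ^ j * t) = 2 ^ j * t + 2 ^ r.-1 * (u * t))%N.
  have -> : r.-1 = ((r - j.+3).+2 + j)%N by lia.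
  rewrite expnD; ring.
have [w ->] : exists w, (u * t = 1 + w * 2)%N.
  by exists (u * t)./2; rewrite muln2 -{1}(odd_double_half (u * t)) oddM ou ot.
rewrite mulnDr muln1 addnA (mulnC w) [X in (_ + X)%N]mulnA -expnSr prednK; last by apply: leq_trans jr.
by rewrite addnC [X in (X + _)%N]mulnC modnMDl.
Qed.

Lemma period_diff_dvd r j t : (0 < r <= m)%N -> (r <= j)%N ->
  period_diff r (2 ^ j * t)%N = period_diff r 0.
Proof.
case/andP=> r0 rm rj; apply: period_diff_modn => //; apply/eqP.
by rewrite mod0n -/(dvdn _ _) dvdn_mulr // dvdn_exp2l.
Qed.

Lemma period_diff_top r t : (0 < r <= m)%N -> odd t ->
  period_diff r (2 ^ r.-1 * t)%N = - period_diff r 0.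
Proof.
move=> rm ot; rewrite -period_diff_half // add0n; case/andP: rm => r0 rm.
apply: period_diff_modn => //; rewrite -{1}(odd_double_half t) ot mulnDr muln1 -mul2n mulnA.
by rewrite -expnSr prednK // mulnC addnC modnMDl.
Qed.

Lemma period_diff_quarter r t (b : bool) : (1 < r <= m)%N -> (t %% 4 = 1 + b.*2)%N ->
  period_diff r (2 ^ r.-2 * t)%N = (-1) ^+ b * period_diff r (2 ^ r.-2)%N.
Proof.
case/andP=> r1 rm tb; have rE : (2 ^ r = 2 ^ r.-2 * 4)%N.
  by case: r r1 {rm} => [|[|r]] // _; rewrite /= -[4%N]/(2 ^ 2)%N -expnD addn2.
have e1 : (2 ^ r.-2 * t = 2 ^ r.-2 * (1 + b.*2) %[mod 2 ^ r])%N.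
  by rewrite rE -!muln_modr tb modn_small //; case: (b).
rewrite (period_diff_modn rm e1); case: (b); last by rewrite addn0 muln1 mul1r.
rewrite mulN1r -period_diff_half ?rm ?(ltnW r1) // mulnDr muln1; congr (period_diff r (_ + _)).
by case: r r1 {rm rE e1} => [|[|r]] // _; rewrite /= -expnSr.
Qed.

(** Since [w ^ k] changes sign under [k -> k + 2 ^ r.-1], only differences of periods survive, and
    among these only [k = 0] and [k = 2 ^ r.-2] give nonvanishing terms. *)
Lemma gauss_period r (w : L) : (1 < r <= m)%N -> w ^+ (2 ^ r.-1) = -1 ->
  \sum_(e < N) w ^+ e * f e =
  period_diff r 0 + w ^+ (2 ^ r.-2) * period_diff r (2 ^ r.-2)%N.
Proof.
case/andP=> r1 rm wr.
have rE : (r.-1 = r.-2.+1)%N by case: r r1 {rm wr} => [|[|]].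
have r0 := ltnW r1.
have w1 : w ^+ (2 ^ r) = 1 by rewrite -(prednK r0) expnSr exprM wr sqrrN expr1n.
have := sum_residues (fun e => w ^+ e * f e) (2 ^ r) (N %/ 2 ^ r).
rewrite (divN rm) => ->.
rewrite (eq_bigr (fun k : 'I_(2 ^ r) => w ^+ k * period r k)); last first.
  move=> k _; rewrite mulr_sumr; apply: eq_bigr => e _.
  by rewrite exprD exprM w1 expr1n mulr1.
transitivity (\sum_(k < 2 ^ r.-1) w ^+ k * period_diff r k).
  have -> : (2 ^ r = 2 ^ r.-1 * 2)%N by rewrite -expnSr prednK.
  rewrite (sum_residues (fun k => w ^+ k * period r k)); apply: eq_bigr => k _.
  rewrite big_ord_recl big_ord1 /= muln0 addn0 muln1 exprD wr.
  by rewrite /period_diff mulrBr mulrN1 mulNr.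
have -> : (2 ^ r.-1 = 2 ^ r.-2 * 2)%N by rewrite rE expnSr.
rewrite (sum_residues (fun k => w ^+ k * period_diff r k)).
have P0 : (0 < 2 ^ r.-2)%N by rewrite expn_gt0.
rewrite (bigD1 (Ordinal P0)) //= [X in _ + X]big1 ?addr0.
  by rewrite big_ord_recl big_ord1 /= muln0 muln1 add0n expr0 mul1r.
move=> k; rewrite -val_eqE /= => k0.
(* Adding a multiple of [2 ^ r.-2] does not change the valuation of [k], which is smaller than
   [r.-2]. *)
have dz (b : nat) : period_diff r (k + 2 ^ r.-2 * b) = 0.
  have k0' : (0 < k)%N by rewrite lt0n.
  pose j := logn 2 k.
  have jr : (j < r.-2)%N.
    rewrite ltnNge; apply/negP => h; have := ltn_ord k; rewrite ltnNge; case/negP.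
    by apply: dvdn_leq => //; rewrite (dvdn_trans (dvdn_exp2l 2 h)) // pfactor_dvdnn.
  have [u cu ku] := pfactor_coprime (isT : prime 2) k0'.
  have -> : (k + 2 ^ r.-2 * b = 2 ^ j * (u + 2 ^ (r.-2 - j) * b))%N.
    by rewrite {1}ku mulnDr mulnA -expnD subnKC 1?ltnW // mulnC.
  apply: period_diff_eq0; first by rewrite rm andbT; lia.
  rewrite oddD oddM oddX /= subn_eq0 leqNgt jr /= addbF.
  by move: cu; rewrite coprime2n.
by rewrite big1 // => b _; rewrite dz mulr0.
Qed.

Lemma gauss_period1 : (0 < m)%N -> \sum_(e < N) (-1) ^+ e * f e = period_diff 1 0.
Proof.
move=> m0; have := sum_residues (fun e => (-1) ^+ e * f e) (2 ^ 1) (N %/ 2 ^ 1).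
rewrite (divN m0) => ->.
rewrite big_ord_recl big_ord1 /= /period_diff /period add0n expn0 -sumrN.
congr (_ + _); apply: eq_bigr => e _; rewrite exprD exprM [(-1) ^+ (2 ^ 1)]sqrrN !expr1n mulr1.
  by rewrite expr0 mul1r.
by rewrite expr1 mulN1r.
Qed.

(** Telescoping: twice a half is the whole plus the difference of the halves, so level [r.+1] adds
    [2 ^ r] times its difference. The start is 0 because [period 0] is the full sum -1. *)
Lemma power_sumE r k : (r <= m)%N ->
  power_sum r k = \sum_(1 <= i < r.+1) 2 ^+ i.-1 * period_diff i k.
Proof.
elim: r => [|r IH] rm.
  rewrite big_geq // /power_sum mul1r.
  have -> : period 0 k = -1; last by rewrite subrr.
  rewrite (@period_modn 0 k 0) ?modn1 // /period expn0 divn1 -f_sum.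
  by apply: eq_bigr => e _; rewrite mul1n.
rewrite big_nat_recr //= -IH; last exact: ltnW.
rewrite /power_sum (period_split k rm) /period_diff /= exprS; ring.
Qed.

Lemma period_diff0 r : (0 < r <= m)%N ->
  period_diff r 0 = 2 * period r 0 - period r.-1 0.
Proof.
by case/andP; case: r => // r _ rm; rewrite /period_diff /= (period_split 0 rm); ring.
Qed.

(** The contribution of the levels [r <= t] to [power_sum m k], common to all [k] divisible by
    [2 ^ t]. *)
Definition low_sum t : L := \sum_(1 <= r < t.+1) 2 ^+ r.-1 * period_diff r 0.

Lemma power_sum0 : power_sum m 0 = low_sum m.
Proof. by rewrite power_sumE. Qed.

Lemma power_sum_top t : (0 < m)%N -> odd t ->
  power_sum m (2 ^ m.-1 * t) = low_sum m.-1 - 2 ^+ m.-1 * period_diff m 0.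
Proof.
move=> m0 ot; rewrite power_sumE // -{1}(prednK m0) big_nat_recr //= prednK //.
rewrite period_diff_top ?m0 ?leqnn // mulrN; congr (_ - _).
rewrite /low_sum prednK //; apply: eq_big_nat => i /andP[i0 im]; rewrite period_diff_dvd //.
  by rewrite i0 ltnW.
by rewrite -ltnS prednK.
Qed.

(** Levels up to [j] see [k] as 0, level [j.+1] sees the opposite half, level [j.+2] sees a quarter
    whose sign is decided by [t] modulo 4, and all higher differences vanish. *)
Lemma power_sum_mid j t (b : bool) : (j.+2 <= m)%N -> (t %% 4 = 1 + b.*2)%N ->
  power_sum m (2 ^ j * t) = low_sum j - 2 ^+ j * period_diff j.+1 0
    + (-1) ^+ b * (2 ^+ j.+1 * period_diff j.+2 (2 ^ j)%N).
Proof.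
move=> jm tb; have ot : odd t by move: tb; clear; case: b => /=; lia.
rewrite power_sumE // (big_cat_nat (n := j.+3)) //=.
rewrite [X in _ + X]big_nat [X in _ + X]big1 ?addr0; last first.
  by move=> i /andP[ji im]; rewrite period_diff_eq0 ?mulr0 //; apply/andP.
rewrite big_nat_recr //= big_nat_recr //=.
rewrite (@period_diff_top j.+1) ?(ltnW jm) // mulrN.
rewrite (@period_diff_quarter j.+2 t b) // mulrCA; congr (_ - _ + _).
apply: eq_big_nat => i /andP[i0 im]; rewrite period_diff_dvd //.
by rewrite i0; apply: leq_trans jm; rewrite ltnW // ltnW.
Qed.

Lemma sum_power_sumX n : (1 < m)%N ->
  \sum_(k < 2 ^ m) power_sum m k ^+ n =
  \sum_(0 <= t < m.-1) 2 ^+ (m - t - 2) *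
    ((low_sum t - 2 ^+ t * period_diff t.+1 0 + 2 ^+ t.+1 * period_diff t.+2 (2 ^ t)%N) ^+ n
   + (low_sum t - 2 ^+ t * period_diff t.+1 0 - 2 ^+ t.+1 * period_diff t.+2 (2 ^ t)%N) ^+ n)
  + (low_sum m.-1 - 2 ^+ m.-1 * period_diff m 0) ^+ n + low_sum m ^+ n.
Proof.
move=> m1; have m0 := ltnW m1.
rewrite (sum_dyadic (fun k => power_sum m k ^+ n)) power_sum0; congr (_ + _).
rewrite -{1}(prednK m0) big_nat_recr //= prednK // subnn big_ord1 muln0 power_sum_top //.
congr (_ + _); apply: eq_big_nat => t /andP[_ tm].
have tm2 : (t.+2 <= m)%N by lia.
have -> : (m - t.+1 = (m - t - 2).+1)%N by lia.
(* The parity of [i] decides whether [1 + 2 * i] is 1 or 3 modulo 4; each class has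
   [2 ^ (m - t - 2)] members. *)
rewrite expnS (sum_residues (fun i => power_sum m (2 ^ t * (1 + 2 * i)) ^+ n)).
rewrite big_ord_recl big_ord1 /= mulrDr.
congr (_ + _).
  rewrite (eq_bigr (fun=> (low_sum t - 2 ^+ t * period_diff t.+1 0
      + 2 ^+ t.+1 * period_diff t.+2 (2 ^ t)%N) ^+ n)) => [|i _].
    by rewrite sumr_const card_ord -[LHS]mulr_natl natrX.
  by rewrite (@power_sum_mid _ _ false) ?mul1r //; lia.
rewrite (eq_bigr (fun=> (low_sum t - 2 ^+ t * period_diff t.+1 0
    - 2 ^+ t.+1 * period_diff t.+2 (2 ^ t)%N) ^+ n)) => [|i _].
  by rewrite sumr_const card_ord -[LHS]mulr_natl natrX.
by rewrite (@power_sum_mid _ _ true) ?mulN1r //; rewrite /bump /=; lia.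
Qed.
End Periods.

(** * The quartic Jacobi sum *)

(** By Legendre's formula it is enough that floors add up: for [k <= s] the remainder of [a] modulo
    [p ^ k] is [(p ^ k - 1) / 4], and three times it stays below [p ^ k]. *)
Lemma prime_ndvd_bin_quarter p s a : prime p -> (p %% 4 = 1)%N -> (p ^ s = 4 * a + 1)%N ->
  ~~ (p %| 'C(3 * a, a))%N.
Proof.
move=> pp p4 pa; have p1 := prime_gt1 pp; have p0 := prime_gt0 pp.
have pX4 k : exists b, (p ^ k = 4 * b + 1)%N.
  exists (p ^ k %/ 4)%N; rewrite {1}(divn_eq (p ^ k) 4) mulnC; congr (_ + _)%N.
  by rewrite -modnXm p4 exp1n.
have term k : (0 < k)%N -> (3 * a %/ p ^ k = a %/ p ^ k + 2 * a %/ p ^ k)%N.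
  move=> _; case: (leqP s k) => sk.
    have : (p ^ s <= p ^ k)%N by rewrite leq_exp2l.
    by rewrite pa => h; rewrite !divn_small //; lia.
  have [b hb] := pX4 (s - k)%N; have [c hc] := pX4 k.
  have aE : (a = b * p ^ k + c)%N.
    have : (p ^ s = p ^ (s - k) * p ^ k)%N by rewrite -expnD subnK // ltnW.
    rewrite pa hb; set P := (p ^ k)%N in hc *; nia.
  have P0 : (0 < p ^ k)%N by rewrite expn_gt0 p0.
  rewrite aE !mulnDr !mulnA !divnMDl // !divn_small ?addn0; [|lia..]; lia.
have ext n M : (n <= M)%N -> (\sum_(1 <= k < n.+1) n %/ p ^ k = \sum_(1 <= k < M.+1) n %/ p ^ k)%N.
  move=> nM; rewrite [RHS](big_cat_nat (n := n.+1)) //=.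
  rewrite [X in (_ + X)%N]big_nat [X in (_ + X)%N]big1 ?addn0 // => k /andP[nk _].
  by rewrite divn_small // (leq_trans nk) // ltnW // ltn_expl.
have fac : (logn p (3 * a)`! = logn p a`! + logn p (2 * a)`!)%N.
  rewrite !logn_fact // (@ext a (3 * a)%N) ?(@ext (2 * a)%N (3 * a)%N); [|lia..].
  by rewrite -big_split /=; apply: eq_big_nat => k /andP[k0 _]; rewrite term.
have a3 : (a <= 3 * a)%N by lia.
have := bin_fact a3; have -> : (3 * a - a = 2 * a)%N by lia.
move/(congr1 (logn p)); rewrite lognM ?muln_gt0 ?fact_gt0 ?bin_gt0 // lognM ?fact_gt0 //.
rewrite fac => e; have : logn p 'C(3 * a, a) = 0%N by lia.
move/eqP; rewrite -[_ == _]negbK -lt0n logn_gt0 mem_primes pp bin_gt0 a3 /= => h.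
exact: h.
Qed.

(** Here [a - c] is odd, so its square is 1 modulo 8 and the norm equation forces 4 to divide
    [b - d]. Then 4 divides [b + d] and [2 c], while [a - c = q - 2 - (b + d) - 2 c]. *)
Lemma two_square_mod4 (q : nat) (a b c d : nat) : (q %% 8 = 1)%N -> (a + b + c + d + 2 = q)%N ->
  ~~ odd b -> ~~ odd c -> ~~ odd d ->
  (a%:Z - c%:Z) ^+ 2 + (b%:Z - d%:Z) ^+ 2 = q%:Z -> (a%:Z - c%:Z = -1 %[mod 4])%Z.
Proof.
move=> q8 qE eb ec ed e.
have [q' qq] : exists q', q = (8 * q' + 1)%N by exists (q %/ 8)%N; lia.
have [b' bE] : exists b', b = (2 * b')%N by exists (b %/ 2)%N; lia.
have [c' cE] : exists c', c = (2 * c')%N by exists (c %/ 2)%N; lia.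
have [d' dE] : exists d', d = (2 * d')%N by exists (d %/ 2)%N; lia.
have [a' aE] : exists a', a = (2 * a' + 1)%N by exists (a %/ 2)%N; lia.
have h : exists w, b'%:Z - d'%:Z = 2 * w.
  have : (a'%:Z - c'%:Z) * (a'%:Z - c'%:Z + 1) + (b'%:Z - d'%:Z) ^+ 2 = 2 * q'%:Z.
    apply: (@mulfI _ (4 : int)) => //.
    have aZ : a%:Z = 2 * a'%:Z + 1 by lia.
    have bZ : b%:Z = 2 * b'%:Z by lia.
    have cZ : c%:Z = 2 * c'%:Z by lia.
    have dZ : d%:Z = 2 * d'%:Z by lia.
    have qZ : q%:Z = 8 * q'%:Z + 1 by lia.
    move: e; rewrite aZ bZ cZ dZ qZ; clear => e.
    by apply: (addIr 1); transitivity (8 * q'%:Z + 1); [rewrite -e|]; ring.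
  have [x ->] : exists x, (a'%:Z - c'%:Z) * (a'%:Z - c'%:Z + 1) = 2 * x.
    set z := _ - _; exists ((z * (z + 1)) %/ 2)%Z.
    have [y [->|->]] : exists y, z = 2 * y \/ z = 2 * y + 1 by exists (z %/ 2)%Z; lia.
      by clear; nia.
    by clear; nia.
  move=> h; apply: int_evenP.
  apply: contraT => /int_oddP[y yE]; exfalso; move: h; rewrite yE; clear; nia.
by case: h => w; lia.
Qed.

(** Classifies [x] by the quartic character of [x * (1 - x)], the summand of the Jacobi sum.
    Counting classes yields integers independent of the field of values, so they can be read in [L]
    and in [F]. *)
Definition quartic_class (F : finFieldType) (g : F) (k : nat) : {set F} :=
  [set x | (x * (1 - x) != 0) && (dlog g (x * (1 - x))%R %% 4 == k)%N].
(* Real and imaginary part of the Jacobi sum of the quartic character sending [g] to [i]. *)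
Definition jacobi_re (F : finFieldType) (g : F) : int :=
  #|quartic_class g 0|%:Z - #|quartic_class g 2|%:Z.
Definition jacobi_im (F : finFieldType) (g : F) : int :=
  #|quartic_class g 1|%:Z - #|quartic_class g 3|%:Z.

Section QuarticJacobi.
Variables (F : finFieldType) (g : F).
Hypothesis g_prim : #|F|.-1.-primitive_root g.
Hypothesis dvd4 : (4 %| #|F|.-1)%N.
Notation N := #|F|.-1.

Lemma sum_indicator (R : nzSemiRingType) (A : {set F}) : \sum_x ((x \in A)%:R : R) = #|A|%:R.
Proof.
by rewrite -sum1_card natr_sum [RHS]big_mkcond; apply: eq_bigr => x _; case: (x \in A).
Qed.

Lemma jacobi_quartic (L : fieldType) (w : L) : w ^+ 2 = -1 ->
  jacobi (power_char g w) (power_char g w) = (jacobi_re g)%:~R + w * (jacobi_im g)%:~R.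
Proof.
move=> w2; have w4 : w ^+ 4 = 1 by rewrite (exprM w 2 2) w2 sqrrN expr1n.
have wN : w ^+ N = 1 by rewrite -(divnK dvd4) mulnC exprM w4 expr1n.
have [_ _ cM] := power_char_mult g_prim wN.
rewrite /jacobi_re /jacobi_im !rmorphB /= -!pmulrn -!sum_indicator -!sumrB mulr_sumr -big_split.
apply: eq_bigr => x _; rewrite -cM !inE /power_char.
case: (eqVneq (x * (1 - x)) 0) => _ /=; first by rewrite !subrr mulr0 addr0.
rewrite -(expr_mod _ w4); have := ltn_pmod (dlog g (x * (1 - x))) (isT : (0 < 4)%N).
case: (_ %% _)%N => [|[|[|[|]]]] //= _.
- by rewrite subrr mulr0 addr0 subr0.
- by rewrite subrr subr0 add0r mulr1.
- by rewrite subrr mulr0 addr0 sub0r w2.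
- by rewrite subrr add0r sub0r mulrN1 exprS w2 mulrN1.
Qed.

Lemma card_finField_natr0 : #|F|%:R = 0 :> F.
Proof.
apply: (addrI (\sum_(x : F) x)); rewrite addr0 -sumr_const -big_split /=.
rewrite [RHS](reindex (fun x => x + 1)) //.
by apply: onW_bij; exists (fun x => x - 1) => x; rewrite ?addrK ?subrK.
Qed.

Lemma sum_exp k : (0 < k)%N -> \sum_(x : F) x ^+ k = if (N %| k)%N then -1 else 0.
Proof.
move=> k0; rewrite (sum_finField g_prim) expr0n eqn0Ngt k0 add0r.
under eq_bigr => e _ do rewrite -exprM mulnC exprM.
have [gk|gk] := boolP (N %| k)%N.
  have -> : g ^+ k = 1 by apply/eqP; rewrite -(prim_order_dvd g_prim).
  rewrite (eq_bigr (fun=> 1)) ?sumr_const ?card_ord => [|e _]; last by rewrite expr1n.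
  apply/eqP; rewrite -addr_eq0 natr1 prednK; last exact: ltnW (finRing_gt1 _).
  by rewrite card_finField_natr0.
have : (g ^+ k - 1) * \sum_(e < N) (g ^+ k) ^+ e = 0.
  by rewrite -subrX1 exprAC (prim_expr_order g_prim) expr1n subrr.
move/eqP; rewrite mulf_eq0 subr_eq0 -(prim_order_dvd g_prim) (negPf gk).
by move/eqP.
Qed.

(** With values in [F], the map [x -> x ^ (3 a)], [a = N / 4], is a quartic character. Expanding
    [x ^ (3 a) (1 - x) ^ (3 a)], only the exponent [4 a = N] is a multiple of [N], so the sum is a
    binomial coefficient up to sign. The conjugate character [x -> x ^ a] would give zero. *)
Lemma jacobi_quartic_neq0 (p s : nat) : prime p -> (p %% 4 = 1)%N -> #|F| = (p ^ s)%N ->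
  exists w : F, (jacobi_re g)%:~R + w * (jacobi_im g)%:~R != 0.
Proof.
move=> pp p4 cF; have N0 := prim_order_gt0 g_prim.
have pc : p \in [pchar F] by apply: card_finPcharP cF pp.
set a := (N %/ 4)%N; have Na : (N = 4 * a)%N by rewrite mulnC /a divnK.
have a0 : (0 < a)%N by move: N0; rewrite Na muln_gt0 => /andP[].
have pa : (p ^ s = 4 * a + 1)%N.
  by rewrite -cF -Na addn1 prednK //; exact: ltnW (finRing_gt1 _).
have w2 : (g ^+ (3 * a)) ^+ 2 = -1.
  have : (g ^+ (2 * a)) ^+ 2 = 1.
    by rewrite -exprM mulnAC -Na (prim_expr_order g_prim).
  move/eqP; rewrite sqrf_eq1 => /orP[/eqP h|/eqP h].
    have : (N %| 2 * a)%N by rewrite (prim_order_dvd g_prim) h.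
    move/dvdn_leq; rewrite muln_gt0 a0 => /(_ isT); rewrite Na; lia.
  transitivity ((g ^+ (2 * a)) ^+ 3); first by rewrite -!exprM; congr (_ ^+ _); lia.
  by rewrite h exprS sqrrN expr1n mulr1.
exists (g ^+ (3 * a)); rewrite -jacobi_quartic //.
have wN : (g ^+ (3 * a)) ^+ N = 1 by rewrite exprAC (prim_expr_order g_prim) expr1n.
have charE x : power_char g (g ^+ (3 * a)) x = x ^+ (3 * a).
  rewrite /power_char; case: eqP => [->|/eqP x0].
    by rewrite expr0n muln_eq0 /= eqn0Ngt a0.
  by rewrite exprAC (dlogK g_prim).
have -> : jacobi (power_char g (g ^+ (3 * a))) (power_char g (g ^+ (3 * a))) =
    - ((-1) ^+ a *+ 'C(3 * a, a)).
  transitivity (\sum_(x : F) \sum_(j < (3 * a).+1) (-1) ^+ j *+ 'C(3 * a, j) * x ^+ (3 * a + j)).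
    apply: eq_bigr => x _; rewrite !charE exprBn mulr_sumr; apply: eq_bigr => j _.
    by rewrite expr1n mulr1 exprD mulrnAl mulrnAr; congr (_ *+ _); rewrite mulrCA.
  rewrite exchange_big /=.
  have aj : (a < (3 * a).+1)%N by lia.
  rewrite (bigD1 (Ordinal aj)) //= -mulr_sumr sum_exp; last by lia.
  have -> : (3 * a + a = N)%N by lia.
  rewrite dvdnn mulrN1 big1 ?addr0 // => j; rewrite -val_eqE /= => ja.
  rewrite -mulr_sumr sum_exp; last by lia.
  case: ifP => [/dvdnP[c hc]|_]; last by rewrite mulr0.
  exfalso; have := ltn_ord j; rewrite ltnS; rewrite Na in hc => hj.
  have : (c = 1)%N by nia.
  by move=> c1; move: ja hc; rewrite c1; lia.
rewrite oppr_eq0 -mulr_natr mulf_neq0 ?signr_eq0 //.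
by rewrite -(dvdn_pcharf pc) (prime_ndvd_bin_quarter pp p4 pa).
Qed.

Lemma jacobi_re_mod4 : (#|F| %% 8 = 1)%N -> (2 : F) != 0 -> ((2 : F) ^+ 2) ^+ (N %/ 4) = 1 ->
  jacobi_re g ^+ 2 + jacobi_im g ^+ 2 = #|F|%:Z ->
  (jacobi_re g = -1 %[mod 4])%Z.
Proof.
move=> q8 two0 four; pose n k := #|quartic_class g k|.
have half : 1 - 2^-1 = 2^-1 :> F.
  by apply: (mulfI two0); rewrite mulrBr mulfV // mulr1; ring.
have inv (x : F) : 1 - (1 - x) = x by rewrite opprB addrC subrK.
(* The involution [x -> 1 - x] preserves the classes and fixes only [1 / 2], where
   [x * (1 - x) = 1 / 4] is a fourth power by assumption; so that point lies in class 0. *)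
have nev k : (0 < k)%N -> ~~ odd (n k).
  move=> k0; rewrite (@odd_card_involution _ _ (fun x => 1 - x)).
  - rewrite (_ : [set x in _ | _] = set0) ?cards0 //; apply/setP => x.
    rewrite in_set0; apply/negP; rewrite !inE => /andP[/andP[x0 /eqP kx] /eqP xx].
    have x2 : x = 2^-1.
      apply: (mulfI two0); rewrite mulfV //; have : x + x = 1 by rewrite -{1}xx subrK.
      by rewrite mulr2n mulrDl mul1r.
    move: x0 kx; rewrite x2 half => x0 kx.
    have : (N %| dlog g (2^-1 * 2^-1)%R * (N %/ 4))%N.
      rewrite (prim_order_dvd g_prim) exprM (dlogK g_prim x0) -invfM -expr2.
      by rewrite exprVn four invr1.
    rewrite -{1}(divnK dvd4) mulnC dvdn_pmul2r ?divn_gt0 //.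
      by rewrite /dvdn kx eqn0Ngt k0.
    by apply: dvdn_leq => //; exact: prim_order_gt0 g_prim.
  - by move=> x; rewrite !inE inv mulrC.
  - by move=> x _; rewrite inv.
move=> h; apply: (@two_square_mod4 #|F| (n 0%N) (n 1%N) (n 2%N) (n 3%N)); rewrite ?nev //.
have -> : (n 0 + n 1 + n 2 + n 3 = #|[set x : F | (x * (1 - x) != 0)%R]|)%N.
  have cE (A : {set F}) : #|A| = (\sum_x (x \in A))%N.
    by rewrite -sum1_card [LHS]big_mkcond; apply: eq_bigr => x _; case: (x \in A).
  rewrite /n !cE -!big_split /=.
  apply: eq_bigr => x _; rewrite !inE; case: (_ != 0) => //=.
  have := ltn_pmod (dlog g (x * (1 - x))) (isT : (0 < 4)%N).
  by case: (_ %% _)%N => [|[|[|[|]]]].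
have -> : [set x : F | x * (1 - x) != 0] = ~: [set 0; 1].
  by apply/setP => x; rewrite !inE mulf_eq0 subr_eq0 negb_or [1 == x]eq_sym negb_or.
have := cardsC [set (0 : F); 1]; rewrite cards2 eq_sym oner_eq0 /= => <-.
by rewrite addnC.
Qed.
End QuarticJacobi.

(** * Relations between the differences of periods *)

(** [b - 1] is 4 times an odd number. With [b] the order of a subfield, this places its units among
    the [2 ^ m.-1]-th powers. *)
Lemma dvdn_pow2_mul m a b : (b %% 8 = 5)%N -> (2 ^ m.+1 %| a * b.-1)%N -> (2 ^ m.-1 %| a)%N.
Proof.
case: m => [|m] //= b8; have [t [ot bE]] : exists t, odd t /\ b.-1 = (4 * t)%N.
  by exists (b %/ 4)%N; split; lia.
rewrite bE mulnCA (_ : 2 ^ m.+2 = 4 * 2 ^ m)%N; last by rewrite !expnS mulnA.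
by rewrite dvdn_pmul2l // mulnC Gauss_dvdr // coprimeXl // coprime2n.
Qed.

Definition gen_char (F : finFieldType) (L : fieldType) (p s : nat) (zeta : L) (g : F) (e : nat) : L :=
  trace_char p s zeta (g ^+ e).

Section Relations.
Variables (F : finFieldType) (p s m : nat).
Hypotheses (p_pr : prime p) (p5 : (p %% 8 = 5)%N) (cardF : #|F| = (p ^ s)%N).
Hypotheses (m_gt1 : (1 < m)%N) (dvd_m : (2 ^ m.+1 %| #|F|.-1)%N).
Variable g : F.
Hypothesis g_prim : #|F|.-1.-primitive_root g.
Variables (L : fieldType) (zeta omega : L).
Hypothesis zeta_prim : p.-primitive_root zeta.
Hypothesis omega_half : omega ^+ (2 ^ m.-1) = -1.
Hypothesis L_char0 : [pchar L] =i pred0.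
Notation N := #|F|.-1.
Notation psi := (@trace_char F L p s zeta).
Notation f := (gen_char p s zeta g).
Notation per := (period f N).
Notation c r := (period_diff f N r 0).
Notation d r := (period_diff f N r (2 ^ r.-2)).

Let N_gt0 : (0 < N)%N := prim_order_gt0 g_prim.
Let natL_neq0 n : (n.+1%:R : L) != 0.
Proof. by rewrite (proj1 (pcharf0P L) L_char0). Qed.
Let m1_neq1 : (-1 : L) != 1.
Proof. by rewrite eq_sym -subr_eq0 opprK (natL_neq0 1). Qed.
Let dvd_mN : (2 ^ m %| N)%N.
Proof. by rewrite (dvdn_trans _ dvd_m) // dvdn_exp2l. Qed.

Lemma gen_char_periodic e : f (e + N) = f e.
Proof. by rewrite /gen_char exprD (prim_expr_order g_prim) mulr1. Qed.

Lemma gen_char_frob e : f (p * e) = f e.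
Proof. by rewrite /gen_char mulnC exprM (trace_char_frob cardF). Qed.

Lemma gen_char_sum : \sum_(e < N) f e = -1.
Proof.
have [p0 _] := trace_char_add_char p_pr cardF zeta_prim.
rewrite (sum_finField g_prim) p0 => /eqP; rewrite addrC addr_eq0 => /eqP <-.
by [].
Qed.

Lemma coprime_p_N : coprime p N.
Proof.
have s0 := card_exp_gt0 cardF; rewrite cardF.
apply: coprime_dvdl (coprimenP _); first by rewrite dvdn_exp.
by rewrite expn_gt0 prime_gt0.
Qed.

Let half_expr (w : L) r : (0 < r)%N -> w ^+ (2 ^ r.-1) = -1 -> w ^+ (2 ^ r) = 1.
Proof. by move=> r0 wr; rewrite -(prednK r0) expnSr exprM wr sqrrN expr1n. Qed.

Let half_exprM (w : L) r k : (0 < r <= m)%N -> w ^+ (2 ^ r.-1) = -1 -> (2 ^ m %| k)%N -> w ^+ k = 1.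
Proof.
case/andP=> r0 rm wr mk; have /dvdnP[j ->] := dvdn_trans (dvdn_exp2l 2 rm) mk.
by rewrite mulnC exprM half_expr // expr1n.
Qed.

Lemma dlog_prime_subfield (a : F) : a ^+ p = a -> a != 0 -> (2 ^ m.-1 %| dlog g a)%N.
Proof.
move=> ap a0; apply: (dvdn_pow2_mul p5); apply: dvdn_trans dvd_m _.
rewrite (prim_order_dvd g_prim) exprM (dlogK g_prim a0) -(inj_eq (mulfI a0)) mulr1 -exprS.
by rewrite prednK ?prime_gt0 // ap.
Qed.

Let nat_frob (t : nat) : (t%:R : F) ^+ p = t%:R.
Proof.
have := frobD p_pr cardF 1; rewrite expn1 => fD.
elim: t => [|t IH]; first by rewrite expr0n -leqn0 leqNgt prime_gt0.
by rewrite -natr1 fD IH expr1n.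
Qed.

Let two_neq0 : (2 : F) != 0.
Proof.
rewrite -(dvdn_pcharf (card_finPcharP cardF p_pr)) gtnNdvd //.
by move: p5; case: (p) => [|[|[|]]].
Qed.

Let dlog2 : (2 ^ m.-1 %| dlog g 2%R)%N.
Proof. by apply: dlog_prime_subfield; rewrite ?nat_frob. Qed.

Lemma gauss_diff r (w : L) : (1 < r <= m)%N -> w ^+ (2 ^ r.-1) = -1 ->
  gauss psi (power_char g w) = c r + w ^+ (2 ^ r.-2) * d r.
Proof.
move=> rm wr; have [r1 rm'] := andP rm.
rewrite (gauss_power_char g_prim); last by apply: (half_exprM _ wr); rewrite ?rm' ?(ltnW r1).
exact: (gauss_period N_gt0 gen_char_periodic dvd_mN p5 coprime_p_N gen_char_frob rm wr).
Qed.

Let sign_expN : (-1 : L) ^+ N = 1.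
Proof. by apply: (@half_exprM _ 1) => //=; rewrite (ltnW m_gt1). Qed.

Lemma gauss_diff1 : gauss psi (power_char g (-1)) = c 1.
Proof.
rewrite (gauss_power_char g_prim) //.
exact: (gauss_period1 f dvd_mN (ltnW m_gt1)).
Qed.

Let half_neq1 (w : L) r : w ^+ (2 ^ r) = -1 -> w != 1.
Proof. by move=> wr; apply: contra_eqN wr => /eqP ->; rewrite expr1n eq_sym m1_neq1. Qed.

(** [-1 = g ^ (N / 2)], and [2 ^ m] divides [N / 2]; this is one place where [2 ^ m.+1], not just
    [2 ^ m], must divide [N]. *)
Let charN1 (w : L) r : (0 < r <= m)%N -> w ^+ (2 ^ r.-1) = -1 -> power_char g w (-1) = 1.
Proof.
move=> rm wr; have wN : w ^+ N = 1 by apply: (half_exprM rm wr).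
have N2 : (2 * (N %/ 2))%N = N.
  by rewrite mulnC divnK // (dvdn_trans _ dvd_m) // dvdn_exp.
have -> : -1 = g ^+ (N %/ 2).
  have : (g ^+ (N %/ 2)) ^+ 2 = 1 by rewrite -exprM mulnC N2 (prim_expr_order g_prim).
  move/eqP; rewrite sqrf_eq1 => /orP[|/eqP ->] //.
  rewrite -(prim_order_dvd g_prim) => /dvdn_leq h.
  have : (0 < N %/ 2)%N by move: N_gt0; rewrite -N2; lia.
  by move/h; rewrite -{1}N2; lia.
rewrite power_char_exp //; apply: (half_exprM rm wr).
by move: dvd_m; rewrite -{1}N2 expnS dvdn_pmul2l.
Qed.

Let inv_half (w : L) k : w ^+ (2 ^ k) = -1 -> w^-1 ^+ (2 ^ k) = -1.
Proof. by move=> h; rewrite exprVn h invrN invr1. Qed.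

Let quarter_sqr (w : L) r : (1 < r)%N -> w ^+ (2 ^ r.-1) = -1 -> (w ^+ (2 ^ r.-2)) ^+ 2 = -1.
Proof. by move=> r1; case: r r1 => [|[|r]] //= _ <-; rewrite -exprM -expnSr. Qed.

Let sqrN1_inv (i : L) : i ^+ 2 = -1 -> i^-1 = - i.
Proof.
move=> i2; have i0 : i != 0.
  by apply: contra_eqN i2 => /eqP ->; rewrite expr0n eq_sym oppr_eq0 oner_eq0.
by apply: (mulfI i0); rewrite mulfV // mulrN -expr2 i2 opprK.
Qed.

Lemma diff1_sqr : c 1 ^+ 2 = #|F|%:R.
Proof.
have mc := power_char_mult g_prim sign_expN.
have g0 := prim_root_neq0 g_prim.
rewrite expr2 -gauss_diff1.
rewrite (gauss_conj (a := g) (trace_char_add_char p_pr cardF zeta_prim) mc mc) //.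
- by rewrite (@charN1 _ 1) ?mul1r //= (ltnW m_gt1).
- by rewrite -{2}[g]expr1 power_char_exp // expr1.
- move=> x x0; rewrite power_charM mulrNN mulr1 /power_char (negPf x0) expr1n //.
Qed.

Let gauss_norm r (w : L) : (0 < r <= m)%N -> w ^+ (2 ^ r.-1) = -1 ->
  gauss psi (power_char g w) * gauss psi (power_char g w^-1) = #|F|%:R.
Proof.
move=> rm wr; have wN : w ^+ N = 1 by apply: (half_exprM rm wr).
have wr' := inv_half wr; have wN' : w^-1 ^+ N = 1 by rewrite exprVn wN invr1.
have g0 := prim_root_neq0 g_prim.
have w0 : w != 0.
  apply: contra_eqN wr => /eqP ->.
  by rewrite expr0n expn_eq0 /= eq_sym oppr_eq0 oner_eq0.
rewrite (gauss_conj (a := g) (trace_char_add_char p_pr cardF zeta_prim)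
  (power_char_mult g_prim wN) (power_char_mult g_prim wN')) //.
- by rewrite (charN1 rm wr') mul1r.
- by rewrite -{2}[g]expr1 power_char_exp // expr1 (half_neq1 wr').
- by move=> x x0; rewrite power_charM mulfV // /power_char (negPf x0) expr1n.
Qed.

Let root_of r : (0 < r <= m)%N -> exists w : L, w ^+ (2 ^ r.-1) = -1.
Proof.
case/andP=> r0 rm; exists (omega ^+ (2 ^ (m - r))).
by rewrite -exprM -expnD -omega_half; congr (_ ^+ (2 ^ _)); lia.
Qed.

(** Inverting [w] turns the square root [i] of -1 into [-i] and leaves [c r], [d r] unchanged, so
    the product of the two Gauss sums is [(c + i d) (c - i d)]. *)
Lemma diff_norm r : (1 < r <= m)%N -> c r ^+ 2 + d r ^+ 2 = #|F|%:R.
Proof.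
move=> rm; have [r1 rm'] := andP rm; have rm0 : (0 < r <= m)%N by rewrite rm' ltnW.
have [w wr] := root_of rm0; have i2 := quarter_sqr r1 wr.
rewrite -(gauss_norm rm0 wr) (gauss_diff rm wr) (gauss_diff rm (inv_half wr)).
rewrite exprVn (sqrN1_inv i2); set i := w ^+ _ in i2 *.
transitivity (c r ^+ 2 - i ^+ 2 * d r ^+ 2); last by ring.
by rewrite i2; ring.
Qed.

Let gauss_sqr r (w : L) : (1 < r <= m)%N -> w ^+ (2 ^ r.-1) = -1 ->
  gauss psi (power_char g w) ^+ 2 =
  gauss psi (power_char g (w * w)) * jacobi (power_char g w) (power_char g w).
Proof.
move=> rm wr; have [r1 rm'] := andP rm; have rm0 : (0 < r <= m)%N by rewrite rm' ltnW.
have wN : w ^+ N = 1 by apply: (half_exprM rm0 wr).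
have mc := power_char_mult g_prim wN; have g0 := prim_root_neq0 g_prim.
rewrite expr2 (gaussM (a := g) (trace_char_add_char p_pr cardF zeta_prim) mc mc) //.
  by congr (_ * _); apply: eq_bigr => x _; rewrite power_charM.
rewrite power_charM -{2}[g]expr1 power_char_exp ?exprMn ?wN ?mulr1 // expr1.
by apply: (@half_neq1 _ r.-2); rewrite -expr2 exprAC (quarter_sqr r1 wr).
Qed.

Let gauss_neq0 r (w : L) : (0 < r <= m)%N -> w ^+ (2 ^ r.-1) = -1 ->
  gauss psi (power_char g w) != 0.
Proof.
move=> rm wr; have := gauss_norm rm wr; apply: contra_eqN => /eqP ->.
by rewrite mul0r eq_sym -(prednK (ltnW (finRing_gt1 F))) natL_neq0.
Qed.

(** Since 4 is a [2 ^ m]-th power, completing the square gives the Jacobi sum of [eta] and [chi].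
    Multiplying [chi] by [eta] replaces [w] by [-w], and the Gauss sum sees [w] only through
    [w ^ (2 ^ r.-2)], an even power for [r > 2]. So the Gauss sums of [chi] and [eta * chi] cancel
    and that of [eta] remains. For [r = 2] the sign of [w] does matter. *)
Let jacobi_pure r (w : L) : (2 < r <= m)%N -> w ^+ (2 ^ r.-1) = -1 ->
  jacobi (power_char g w) (power_char g w) = c 1.
Proof.
move=> rm wr; have [r2 rm'] := andP rm; have r1 := ltnW r2.
have rm1 : (1 < r <= m)%N by rewrite rm' r1.
have rm0 : (0 < r <= m)%N by rewrite rm' (ltnW r1).
have wN : w ^+ N = 1 by apply: (half_exprM rm0 wr).
have mc := power_char_mult g_prim wN; have g0 := prim_root_neq0 g_prim.
have rE : r.-2 = r.-2.-1.+1 by case: (r) r2 => [|[|[|]]].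
have wm : (- w) ^+ (2 ^ r.-2) = w ^+ (2 ^ r.-2).
  by rewrite rE expnS exprM sqrrN -exprM.
have wr' : (- w) ^+ (2 ^ r.-1) = -1.
  by rewrite exprNn wr -signr_odd oddX orbF -subn1 subn_eq0 leqNgt r1 mul1r.
have four1 : power_char g w (2 ^+ 2) = 1.
  rewrite -{1}(dlogK g_prim two_neq0) -exprM power_char_exp //.
  apply: (half_exprM rm0 wr); rewrite -(prednK (ltnW m_gt1)) expnSr.
  by rewrite dvdn_mul.
have eta_mc := power_char_mult g_prim sign_expN.
have evN : ~~ odd N.
  by rewrite -dvdn2 (dvdn_trans _ dvd_m) // dvdn_exp.
have gw : power_char g w g = w by rewrite -{2}[g]expr1 power_char_exp // expr1.
have gm : power_char g (-1 : L) g = -1 by rewrite -{2}[g]expr1 power_char_exp // expr1.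
have := jacobi_diag mc g0 _ two_neq0 (fun h => sum_squares g_prim h evN).
rewrite gw four1 mul1r => ->; last by rewrite (half_neq1 wr).
have := gaussM (a := g) (trace_char_add_char p_pr cardF zeta_prim) eta_mc mc g0.
rewrite gm gw mulN1r (half_neq1 wr') => /(_ isT).
have -> : gauss psi (fun x => power_char g (-1) x * power_char g w x) =
    gauss psi (power_char g (- w)).
  by apply: eq_bigr => x _; rewrite power_charM mulN1r.
rewrite (gauss_diff rm1 wr') wm -(gauss_diff rm1 wr) gauss_diff1 mulrC.
by move/(mulfI (gauss_neq0 rm0 wr)).
Qed.

(** Adding the duplication formulas for [w] and its inverse isolates the part without [i]; squaring
    the character lowers the level but keeps the same [i]. *)
Lemma diff_sqrB r : (2 < r <= m)%N -> c r ^+ 2 - d r ^+ 2 = c 1 * c r.-1.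
Proof.
move=> rm; have [r2 rm'] := andP rm; have r1 := ltnW r2.
have rm1 : (1 < r <= m)%N by rewrite rm' r1.
have rm0 : (0 < r <= m)%N by rewrite rm' (ltnW r1).
have [w wr] := root_of rm0; have i2 := quarter_sqr r1 wr.
have rP : (1 < r.-1 <= m)%N by rewrite (leq_trans (leq_pred _) rm') andbT; case: (r) r2.
have rel (z : L) : z ^+ (2 ^ r.-1) = -1 ->
    (c r + z ^+ (2 ^ r.-2) * d r) ^+ 2 = (c r.-1 + z ^+ (2 ^ r.-2) * d r.-1) * c 1.
  move=> zr; rewrite -(gauss_diff rm1 zr) (gauss_sqr rm1 zr) (jacobi_pure rm zr).
  have zz : (z * z) ^+ (2 ^ r.-2) = -1.
    by rewrite -expr2 exprAC (quarter_sqr r1 zr).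
  rewrite (gauss_diff rP zz) -expr2 -exprM -expnS.
  by case: (r) r2 => [|[|[|]]].
have e1 := rel w wr; have e2 := rel w^-1 (inv_half wr).
rewrite exprVn (sqrN1_inv i2) in e2; set i := w ^+ _ in i2 e1 e2.
apply: (mulfI (natL_neq0 1)).
transitivity ((c r + i * d r) ^+ 2 + (c r + - i * d r) ^+ 2).
  by transitivity (2 * (c r ^+ 2 + i ^+ 2 * d r ^+ 2)); [rewrite i2; ring | ring].
by rewrite e1 e2; ring.
Qed.

Let diff2_rel (z : L) : z ^+ 2 = -1 ->
  (c 2 + z * d 2) ^+ 2 = c 1 * ((jacobi_re g)%:~R + z * (jacobi_im g)%:~R).
Proof.
move=> z2; have rm : (1 < 2 <= m)%N by [].
rewrite -{1}[z](expr1 z) -(gauss_diff rm z2) (gauss_sqr rm z2) -expr2 z2 gauss_diff1.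
by rewrite (jacobi_quartic g_prim) // (dvdn_trans _ dvd_mN) // (@dvdn_exp2l 2 2 m).
Qed.

Lemma diff2_sqrB : c 2 ^+ 2 - d 2 ^+ 2 = c 1 * (jacobi_re g)%:~R.
Proof.
have [i i2] : exists w : L, w ^+ (2 ^ 2.-1) = -1 by apply: root_of; rewrite /= m_gt1.
have e1 := diff2_rel i2.
have e2 : (c 2 + - i * d 2) ^+ 2 = c 1 * ((jacobi_re g)%:~R + - i * (jacobi_im g)%:~R).
  by apply: diff2_rel; rewrite sqrrN.
apply: (mulfI (natL_neq0 1)).
transitivity ((c 2 + i * d 2) ^+ 2 + (c 2 + - i * d 2) ^+ 2).
  by transitivity (2 * (c 2 ^+ 2 + i ^+ 2 * d 2 ^+ 2)); [rewrite i2; ring | ring].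
by rewrite e1 e2; ring.
Qed.

Lemma intr_injL (a b : int) : a%:~R = b%:~R :> L -> a = b.
Proof.
move/eqP; rewrite -subr_eq0 -rmorphB /= => h; apply/eqP; rewrite -subr_eq0.
case: (a - b) h => n; rewrite ?NegzE ?mulrNz ?oppr_eq0 ?pmulrn -?pmulrn.
  by rewrite (proj1 (pcharf0P L) L_char0).
by rewrite (negPf (natL_neq0 n)).
Qed.

Lemma jacobi_norm : jacobi_re g ^+ 2 + jacobi_im g ^+ 2 = #|F|%:Z.
Proof.
have [i i2] : exists w : L, w ^+ (2 ^ 2.-1) = -1 by apply: root_of; rewrite /= m_gt1.
have e1 := diff2_rel i2.
have e2 : (c 2 + - i * d 2) ^+ 2 = c 1 * ((jacobi_re g)%:~R + - i * (jacobi_im g)%:~R).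
  by apply: diff2_rel; rewrite sqrrN.
have n2 : c 2 ^+ 2 + d 2 ^+ 2 = #|F|%:R by apply: diff_norm.
have q0 : (#|F|%:R : L) != 0 by rewrite -(prednK (ltnW (finRing_gt1 F))) natL_neq0.
apply: intr_injL; rewrite rmorphD !rmorphXn /= -pmulrn; apply: (mulfI q0).
transitivity (((c 2 + i * d 2) * (c 2 + - i * d 2)) ^+ 2).
  rewrite exprMn e1 e2 -{1}diff1_sqr.
  set u := (jacobi_re g)%:~R; set v := (jacobi_im g)%:~R.
  by transitivity (c 1 ^+ 2 * (u ^+ 2 - i ^+ 2 * v ^+ 2)); [rewrite i2; ring | ring].
rewrite (_ : (c 2 + i * d 2) * (c 2 + - i * d 2) = #|F|%:R) ?expr2 // -n2.
by transitivity (c 2 ^+ 2 - i ^+ 2 * d 2 ^+ 2); [ring | rewrite i2; ring].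
Qed.

Lemma jacobi_re_ndvd : ~~ (p%:Z %| jacobi_re g)%Z.
Proof.
have p4 : (p %% 4 = 1)%N by move: p5; lia.
have d4 : (4 %| N)%N by rewrite (dvdn_trans _ dvd_mN) // (@dvdn_exp2l 2 2 m).
have [w] := jacobi_quartic_neq0 g_prim d4 p_pr p4 cardF.
have pc := card_finPcharP cardF p_pr.
have int0 (a : int) : (p%:Z %| a)%Z -> (a%:~R : F) = 0.
  by case/dvdzP => b ->; rewrite rmorphM /= -pmulrn (pcharf0 pc) mulr0.
apply: contraNN => pu; rewrite int0 // int0 ?mulr0 ?addr0 //.
have : (p%:Z %| jacobi_im g ^+ 2)%Z.
  have -> : jacobi_im g ^+ 2 = #|F|%:Z - jacobi_re g ^+ 2 by rewrite -jacobi_norm; ring.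
  rewrite rpredB ?expr2 ?dvdz_mulr // cardF dvdzE dvdn_exp //.
  exact: card_exp_gt0 cardF.
by rewrite expr2 !dvdzE abszM Euclid_dvdM // orbb.
Qed.

Lemma jacobi_re_modz : (jacobi_re g = -1 %[mod 4])%Z.
Proof.
have d4 : (4 %| N)%N by rewrite (dvdn_trans _ dvd_mN) // (@dvdn_exp2l 2 2 m).
have d8 : (8 %| N)%N by rewrite (dvdn_trans _ dvd_m) // (@dvdn_exp2l 2 3 m.+1).
apply: (jacobi_re_mod4 g_prim d4) => //.
- by have := finRing_gt1 F; move: d8; lia.
(* As [m >= 2], 2 is an even power of [g], so 4 is a fourth power. *)
- rewrite -{1}(dlogK g_prim two_neq0) -!exprM; apply/eqP; rewrite -(prim_order_dvd g_prim).
  have Na : (4 * (N %/ 4))%N = N by rewrite mulnC divnK.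
  rewrite -{1}Na mulnA; apply: dvdn_mul => //; apply: (@dvdn_mul 2 2) => //.
  by apply: dvdn_trans dlog2; apply: (@dvdn_exp2l 2 1); rewrite -ltnS prednK // ltnW.
- exact: jacobi_norm.
Qed.

(** Describing a coset by a binomial equation makes its behaviour under Frobenius and under scaling
    visible. *)
Lemma sum_coset (h : F -> L) A B k : (A * B)%N = N -> (k < A)%N ->
  \sum_(y in [set y : F | y ^+ B == g ^+ (k * B)]) h y = \sum_(e < B) h (g ^+ (k + A * e)).
Proof.
move=> AB kA; have B0 : (0 < B)%N by move: N_gt0; rewrite -AB muln_gt0 => /andP[].
have g0 := prim_root_neq0 g_prim.
rewrite big_mkcond (sum_finField g_prim) inE expr0n eqn0Ngt B0 eq_sym.
rewrite expf_eq0 (negPf g0) andbF add0r.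
have := sum_residues (fun e => if g ^+ e \in [set y : F | y ^+ B == g ^+ (k * B)]
  then h (g ^+ e) else 0) A B.
rewrite AB => ->; rewrite (bigD1 (Ordinal kA)) //= [X in _ + X]big1 ?addr0.
  apply: eq_bigr => e _; rewrite inE -exprM mulnDl mulnAC AB exprD [g ^+ (N * _)]exprM.
  by rewrite (prim_expr_order g_prim) expr1n mulr1 eqxx.
move=> i; rewrite -val_eqE /= => ik; rewrite big1 // => e _.
rewrite inE -exprM mulnDl mulnAC AB exprD [g ^+ (N * _)]exprM.
rewrite (prim_expr_order g_prim) expr1n mulr1 (eq_prim_root_expr g_prim) -AB.
by rewrite !modn_small ?ltn_pmul2r // eqn_pmul2r // (negPf ik).
Qed.

Let M_div r : (r <= m)%N -> (2 ^ r * (N %/ 2 ^ r))%N = N.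
Proof. by move=> rm; rewrite mulnC divnK // (dvdn_trans _ dvd_mN) // dvdn_exp2l. Qed.

Let predp_dvd_M b r : (b %% 8 = 5)%N -> (b.-1 %| N)%N -> (r < m)%N -> (b.-1 %| N %/ 2 ^ r)%N.
Proof.
move=> b8 /dvdnP[k Nk] rm.
have : (2 ^ m.-1 %| k)%N by apply: (dvdn_pow2_mul b8); rewrite -Nk.
have rm1 : (r <= m.-1)%N by rewrite -ltnS prednK // ltnW.
move/(dvdn_trans (dvdn_exp2l 2 rm1)) => /dvdnP[j kj].
by rewrite Nk kj mulnAC mulnK ?expn_gt0 // dvdn_mull.
Qed.

Let pX_mod8 k : odd k -> (p ^ k %% 8 = 5)%N.
Proof.
move=> ok; rewrite -(odd_double_half k) ok expnD expn1 -mul2n expnM -modnMm p5.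
have p2 : (p ^ 2 %% 8 = 1)%N by rewrite -modnXm p5.
by rewrite -(modnXm k./2 8 (p ^ 2)) p2 exp1n.
Qed.

(** The subfield used is that of order [p ^ k], [k] the odd part of [s]: its index is a power of 2,
    and [p ^ k] is again 5 modulo 8, so for [r < m] its units are [2 ^ r]-th powers. *)
Lemma period0_odd r : (r < m)%N -> exists2 E : int, per r 0 = E%:~R & ~~ (2 %| E)%Z.
Proof.
move=> rm; have s0 := card_exp_gt0 cardF.
have [k ck sE] := pfactor_coprime (isT : prime 2) s0.
have ok : odd k by move: ck; rewrite coprime2n.
have MN := M_div (ltnW rm); set M := (N %/ 2 ^ r)%N in MN.
have po : odd p by move: p5; lia.
have M0 : (0 < M)%N by move: N_gt0; rewrite -MN muln_gt0 => /andP[].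
have [|||E hE oE] := odd_period p_pr cardF zeta_prim L_char0 po (etrans sE (mulnC _ _)) M0.
- rewrite -dvdn2; have : (2 ^ r.+1 %| N)%N.
    by rewrite (dvdn_trans _ dvd_m) // dvdn_exp2l // ltnW.
  by rewrite -MN expnSr dvdn_pmul2l // expn_gt0.
- by apply: predp_dvd_M => //; rewrite cardF dvdn_pred_predX.
- apply: predp_dvd_M => //; first exact: pX_mod8.
  by rewrite cardF sE expnM dvdn_pred_predX.
exists E => //; rewrite -hE.
have := sum_coset psi MN (expn_gt0 2 r); rewrite mul0n expr0 => ->.
by apply: eq_bigr => e _; rewrite add0n.
Qed.

(** A unit of the prime field has [2 M]-th power 1, so it fixes or exchanges the solution sets of
    [y ^ M = 1] and [y ^ M = -1]. The pairs with one entry in each, in both orders (whence the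
    factor 2), form a stable set, even for [r.+1 = m], where single periods need not be integers. *)
Lemma period_prod_int r : (r < m)%N ->
  exists n : int, 2 * per r.+1 0 * per r.+1 (2 ^ r) = n%:~R.
Proof.
move=> rm; have MN := M_div rm; set M := (N %/ 2 ^ r.+1)%N in MN.
have M2 : (2 * M)%N = (N %/ 2 ^ r)%N.
  by rewrite -MN expnSr -mulnA mulKn // expn_gt0.
have MN2 : (2 ^ r * M * 2)%N = N by rewrite -MN expnS; ring.
have gM : g ^+ (2 ^ r * M) = -1.
  have : (g ^+ (2 ^ r * M)) ^+ 2 = 1 by rewrite -exprM MN2 (prim_expr_order g_prim).
  move/eqP; rewrite sqrf_eq1 => /orP[|/eqP //].
  rewrite -(prim_order_dvd g_prim) => /dvdn_leq h.
  have : (0 < 2 ^ r * M)%N by move: N_gt0; rewrite -MN2; lia.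
  by move/h; rewrite -{1}MN2; lia.
have lt1 : (0 < 2 ^ r.+1)%N by rewrite expn_gt0.
have lt2 : (2 ^ r < 2 ^ r.+1)%N by rewrite ltn_exp2l.
have E1 := sum_coset psi MN lt1; have E2 := sum_coset psi MN lt2.
rewrite mul0n expr0 in E1; rewrite gM in E2.
have P1 : per r.+1 0 = \sum_(y in [set y : F | y ^+ M == 1]) psi y.
  by rewrite E1; apply: eq_bigr.
have P2 : per r.+1 (2 ^ r) = \sum_(y in [set y : F | y ^+ M == -1]) psi y.
  by rewrite E2.
set X := [set y | _] in P1; set Y := [set y | _] in P2.
have F1 : (1 : F) != -1 by rewrite -subr_eq0 opprK.
have [] := @trace_pair_int F p s p_pr cardF L zeta zeta_prim
  [set z : F * F | (z.1 ^+ (2 * M) == 1) && (z.2 ^+ M == - z.1 ^+ M)].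
  move=> a z ap a0; rewrite !inE /= !exprMn -mulrN => /andP[/eqP z1 /eqP z2].
  have : a ^+ (2 * M) = 1.
    have /dvdnP[j ->] : (p.-1 %| 2 * M)%N.
      by rewrite M2; apply: predp_dvd_M => //; rewrite cardF dvdn_pred_predX.
    rewrite mulnC exprM (_ : a ^+ p.-1 = 1) ?expr1n //; apply: (mulfI a0).
    by rewrite -exprS prednK ?prime_gt0 // mulr1.
  by move=> ->; rewrite z1 z2 mulr1 !eqxx.
move=> n hn; exists n; rewrite -hn P1 P2.
transitivity ((\sum_(y in X) psi y) * (\sum_(z in Y) psi z)
  + (\sum_(y in Y) psi y) * (\sum_(z in X) psi z)); first by ring.
rewrite !big_distrlr /= !pair_big /=.
rewrite big_mkcond [X in _ + X]big_mkcond [RHS]big_mkcond -big_split /=.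
apply: eq_bigr => -[y z] _ /=; rewrite !inE /= mulnC exprM sqrf_eq1.
case: (eqVneq (y ^+ M) 1) => [->|y1] /=; first by rewrite (negPf F1) /= addr0.
case: (eqVneq (y ^+ M) (-1)) => [->|ym] /=; last by rewrite addr0.
by rewrite opprK add0r.
Qed.
End Relations.

(** * Determination of the differences of periods, level by level *)

Section Solve.
Variables (F : finFieldType) (p s m : nat).
Hypotheses (p_pr : prime p) (p5 : (p %% 8 = 5)%N) (cardF : #|F| = (p ^ s)%N).
Hypotheses (m_gt1 : (1 < m)%N) (dvd_m : (2 ^ m.+1 %| #|F|.-1)%N).
Variable g : F.
Hypothesis g_prim : #|F|.-1.-primitive_root g.
Variables (L : fieldType) (zeta omega : L).
Hypothesis zeta_prim : p.-primitive_root zeta.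
Hypothesis omega_half : omega ^+ (2 ^ m.-1) = -1.
Hypothesis L_char0 : [pchar L] =i pred0.
Notation N := #|F|.-1.
Notation psi := (@trace_char F L p s zeta).
Notation f := (gen_char p s zeta g).
Notation per := (period f N).
Notation c r := (period_diff f N r 0).
Notation d r := (period_diff f N r (2 ^ r.-2)).

Let dvd_mN : (2 ^ m %| N)%N.
Proof. by rewrite (dvdn_trans _ dvd_m) // dvdn_exp2l. Qed.
Let per_eq r k k' : (r <= m)%N -> (k = k' %[mod 2 ^ r])%N -> per r k = per r k'.
Proof. by move=> rm; apply: (period_modn (gen_char_periodic p s g_prim zeta) dvd_mN). Qed.

Lemma power_sum_expE k :
  \sum_x psi (g ^+ k * x ^+ (2 ^ m)) = power_sum f N m k.
Proof.
have MN : (2 ^ m * (N %/ 2 ^ m))%N = N by rewrite mulnC divnK.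
by rewrite (sum_powers g_prim _ _ MN) (trace_char0 p_pr cardF zeta_prim) /power_sum -natrX mulr_natl.
Qed.

Lemma Nsol_power_sum n :
  (Nsol F n m)%:R * #|F|%:R =
  #|F|%:R ^+ n + (N %/ 2 ^ m)%:R * \sum_(k < 2 ^ m) power_sum f N m k ^+ n :> L.
Proof.
have ap := trace_char_add_char p_pr cardF zeta_prim; have [psi0 psiD psi_sum] := ap.
have MN : (2 ^ m * (N %/ 2 ^ m))%N = N by rewrite mulnC divnK.
transitivity (\sum_a \sum_(x : {ffun 'I_n -> F}) psi (a * \sum_(i < n) x i ^+ (2 ^ m))).
  rewrite exchange_big /= /Nsol -sum1_card natr_sum mulr_suml big_mkcond /=.
  apply: eq_bigr => x _; under [RHS]eq_bigr => a _ do rewrite mulrC.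
  by rewrite (add_char_sum _ ap) inE; case: ifP; rewrite ?mul1r.
transitivity (\sum_a (\sum_x psi (a * x ^+ (2 ^ m))) ^+ n).
  apply: eq_bigr => a _; rewrite -[n in RHS]card_ord -prodr_const bigA_distr_bigA /=.
  apply: eq_bigr => x _; rewrite mulr_sumr.
  by elim/big_rec2: _ => [|i y z _ <-]; rewrite ?psi0 // psiD.
rewrite (sum_finField g_prim); congr (_ + _).
  by congr (_ ^+ n); under eq_bigr => x _ do rewrite mul0r psi0; rewrite sumr_const.
under eq_bigr => e _ do rewrite power_sum_expE.
have := sum_residues (fun e => power_sum f N m e ^+ n) (2 ^ m) (N %/ 2 ^ m).
rewrite MN => ->; rewrite mulr_sumr; apply: eq_bigr => k _.
rewrite (eq_bigr (fun=> power_sum f N m k ^+ n)) ?sumr_const ?card_ord ?mulr_natl // => e _.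
by rewrite /power_sum (@per_eq m _ k) // addnC mulnC modnMDl.
Qed.

Variables C D : nat -> int.
Notation a r := (C r ^+ 2 + D r ^+ 2).
Hypothesis a1 : a 1 = (p ^ s)%:Z.
Hypothesis aS : forall r, (0 < r < m)%N -> a r.+1 ^+ 2 = a r.
Hypothesis C_mod4 : forall r, (0 < r <= m)%N -> (C r = -1 %[mod 4])%Z.
Hypothesis C_ndvd : forall r, (0 < r <= m)%N -> ~~ (p%:Z %| C r)%Z.

Let s_gt0 : (0 < s)%N := card_exp_gt0 cardF.
Let injZ := intr_injL L_char0.
Let twoL : (2 : L) != 0.
Proof. by rewrite (proj1 (pcharf0P L) L_char0). Qed.
Let qE : #|F|%:R = (a 1)%:~R :> L.
Proof. by rewrite a1 cardF pmulrn. Qed.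
Let a_mod4 r (rm : (0 < r <= m)%N) := tower_mod4 p_pr p5 s_gt0 a1 aS C_mod4 rm.
Let tC r (rm : (1 < r <= m)%N) := tower_C p_pr p5 s_gt0 a1 aS C_mod4 C_ndvd rm.
Let c_int r : (0 < r < m)%N -> exists z : int, c r = z%:~R.
Proof.
case/andP=> r0 rm.
have r1 : (r.-1 < m)%N by apply: leq_ltn_trans (leq_pred _) rm.
have [E hE _] := period0_odd p_pr p5 cardF m_gt1 dvd_m g_prim zeta_prim L_char0 rm.
have [E' hE' _] := period0_odd p_pr p5 cardF m_gt1 dvd_m g_prim zeta_prim L_char0 r1.
exists (2 * E - E'); rewrite (period_diff0 f dvd_mN) ?r0 ?(ltnW rm) //.
by rewrite hE hE' rmorphB rmorphM.
Qed.

(** The square is known, and [c 1 = 2 E + 1] with [E] odd is -1 modulo 4, whereas [a 2] is 1 modulo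
    4. This fixes the sign of the quadratic Gauss sum. *)
Lemma diff1_value : c 1 = - (a 2)%:~R.
Proof.
have [E hE oE] := period0_odd p_pr p5 cardF m_gt1 dvd_m g_prim zeta_prim L_char0 m_gt1.
have c1 : c 1 = (2 * E + 1)%:~R.
  rewrite (period_diff0 f dvd_mN) ?(ltnW m_gt1) //= hE rmorphD rmorphM /=; congr (_ + _).
  have -> : per 0 0 = -1; last by rewrite opprK.
  rewrite /period expn0 divn1 -(gen_char_sum p_pr cardF g_prim zeta_prim).
  by apply: eq_bigr => e _; rewrite mul1n.
have : c 1 ^+ 2 = (a 2)%:~R ^+ 2.
  rewrite (diff1_sqr p_pr p5 cardF m_gt1 dvd_m g_prim zeta_prim L_char0) qE -aS ?m_gt1 //.
  by rewrite rmorphXn.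
move/eqP; rewrite eqf_sqr => /orP[/eqP h|/eqP //]; exfalso.
have [y ey] := a_mod4 (r := 2) m_gt1; have [z ez] := int_oddP oE.
by move: h; rewrite c1 => /injZ; rewrite ey ez; clear; lia.
Qed.

Let diff_sum r (rm : (1 < r <= m)%N) :=
  diff_norm p_pr p5 cardF m_gt1 dvd_m g_prim zeta_prim omega_half L_char0 rm.

Let diff_double r : (2 < r <= m)%N -> 2 * c r ^+ 2 = (a 1)%:~R - (a 2)%:~R * c r.-1.
Proof.
move=> rm; have rm1 : (1 < r <= m)%N by case/andP: rm => /ltnW -> ->.
have h := diff_sqrB p_pr p5 cardF m_gt1 dvd_m g_prim zeta_prim omega_half L_char0 rm.
have -> : (a 2)%:~R = - c 1 by rewrite diff1_value opprK.
by rewrite -qE -(diff_sum rm1) mulNr opprK -h; ring.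
Qed.

(* [2 c_(r+1)^2 = q - a_2 c_r] is congruent to [2] modulo [4], which forces
   [c_r = -1] modulo [4]. *)
Lemma diff_mod4 r (z : int) : (1 < r < m)%N -> c r = z%:~R -> exists y, z = 4 * y - 1.
Proof.
case/andP=> r1 rm hz; have r0 := ltnW r1.
have [E hE oE] := period0_odd p_pr p5 cardF m_gt1 dvd_m g_prim zeta_prim L_char0 rm.
have [n hn] := period_prod_int p_pr p5 cardF m_gt1 dvd_m g_prim zeta_prim L_char0 rm.
(* The squared difference of the two half periods is [E ^ 2] minus four times their product, and [n]
   is twice that product. *)
have e1 : 2 * c r.+1 ^+ 2 = (2 * E ^+ 2 - 4 * n)%:~R.
  rewrite rmorphB !rmorphM /= -hn -hE (period_split _ dvd_mN 0 rm) /period_diff /= add0n.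
  by ring.
have e2 : 2 * c r.+1 ^+ 2 = (a 1 - a 2 * z)%:~R.
  by rewrite diff_double ?ltnS ?r1 ?rm //= hz rmorphB rmorphM.
have /injZ h := etrans (esym e1) e2.
have [y ey] := a_mod4 (r := 1) (ltnW m_gt1); have [x ex] := a_mod4 (r := 2) m_gt1.
have [t et] := int_oddP oE.
exists (y - x * z - 2 * t ^+ 2 - 2 * t + n); move: h; rewrite ey ex et; clear => h.
transitivity (4 * y + 1 - (4 * y + 1 - (4 * x + 1) * z) - 4 * x * z); first by ring.
by rewrite -h; ring.
Qed.

Let jacobi_re_value : jacobi_re g = C 1%N.
Proof.
have jm := jacobi_re_modz p_pr p5 cardF m_gt1 dvd_m g_prim zeta_prim omega_half L_char0.
have jn := jacobi_norm p_pr p5 cardF m_gt1 dvd_m g_prim zeta_prim omega_half L_char0.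
have jd := jacobi_re_ndvd p_pr p5 cardF m_gt1 dvd_m g_prim zeta_prim omega_half L_char0.
have rm : (0 < 1 <= m)%N by rewrite (ltnW m_gt1).
have [y yE] := mod4N1P jm; have [z zE] := mod4N1P (C_mod4 rm).
have po : odd p by move: p5; clear; lia.
have : jacobi_re g ^+ 2 = C 1%N ^+ 2.
  apply: (two_squares_unique p_pr s_gt0 (etrans jn (congr1 Posz cardF)) a1) => //.
  - exact: C_ndvd.
  - by rewrite yE; clear; lia.
  - by rewrite zE; clear; lia.
  - by rewrite dvdzE /= dvdn2 oddX po orbT.
move/eqP; rewrite eqf_sqr => /orP[/eqP //|/eqP]; rewrite yE zE; clear; lia.
Qed.

(** These are [c r ^ 2 = (a 1 / a r) C r ^ 2] and [c r = (a 2 / a r.+1) C r], cleared of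
    denominators. In the induction [2 c r.+1 ^ 2 = a 1 - a 2 * c r] matches
    [2 C r.+1 ^ 2 = a r.+1 - C r], because [a r.+1 * c r = a 2 * C r] and [a 2 ^ 2 = a 1]. *)
Lemma diff_values r : (1 < r <= m)%N ->
  (a r)%:~R * c r ^+ 2 = (a 1)%:~R * (C r)%:~R ^+ 2 /\
  ((r < m)%N -> (a r.+1)%:~R * c r = (a 2)%:~R * (C r)%:~R).
Proof.
(* Both sides have the same square. Modulo 4 every [a] is 1 while [c r] and [C r] are -1, so
   opposite signs are impossible. *)
move: r; have sign r : (1 < r < m)%N -> (a r)%:~R * c r ^+ 2 = (a 1)%:~R * (C r)%:~R ^+ 2 ->
    (a r.+1)%:~R * c r = (a 2)%:~R * (C r)%:~R.
  case/andP=> r1 rm e; have r0 := ltnW r1.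
  have : ((a r.+1)%:~R * c r) ^+ 2 = ((a 2)%:~R * (C r)%:~R) ^+ 2.
    rewrite !exprMn -[(a r.+1)%:~R ^+ 2]rmorphXn -[(a 2)%:~R ^+ 2]rmorphXn /=.
    by rewrite !aS ?m_gt1 ?r0 ?rm.
  move/eqP; rewrite eqf_sqr => /orP[/eqP //|/eqP h]; exfalso.
  have [z hz] := c_int (introT andP (conj r0 rm)).
  have [|y ey] := diff_mod4 (r := r) _ hz; first by rewrite r1 rm.
  have [x ex] := a_mod4 (r := r.+1) rm; have [w ew] := a_mod4 (r := 2) m_gt1.
  have [t et] := mod4N1P (C_mod4 (r := r) (introT andP (conj r0 (ltnW rm)))).
  have : a r.+1 * z = - (a 2 * C r).
    by apply: injZ; rewrite rmorphN !rmorphM /= -h hz.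
  rewrite ex ey ew et; clear => h.
  have : 4 * (4 * x * y - x + y + 4 * w * t - w + t) = 2.
    transitivity ((4 * x + 1) * (4 * y - 1) + (4 * w + 1) * (4 * t - 1) + 2); first by ring.
    by rewrite h; ring.
  by move: (_ + t); lia.
elim=> [|r IH] // /andP[r1 rm].
have key : (a r.+1)%:~R * c r.+1 ^+ 2 = (a 1)%:~R * (C r.+1)%:~R ^+ 2.
  apply: (mulfI twoL).
  have cc : 2 * (C r.+1)%:~R ^+ 2 = (a r.+1)%:~R - (C r)%:~R :> L.
    have := tC (r := r.+1); rewrite r1 rm => /(_ isT) /= h.
    have -> : (C r)%:~R = - (C r.+1 ^+ 2 - D r.+1 ^+ 2)%:~R :> L by rewrite h rmorphN opprK.
    by rewrite rmorphB rmorphD !rmorphXn /=; ring.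
  rewrite [RHS]mulrCA cc mulrCA.
  (* Level 2 is the base case: there [C 1] enters as the real part of the quartic Jacobi sum, not
     through a lower difference. *)
  case: (leqP r 1) => hr.
    have r11 : r = 1%N by apply/eqP; rewrite eqn_leq hr -ltnS r1.
    move: cc rm; rewrite r11 => cc rm.
    have h1 := diff_sum (r := 2) rm.
    have h2 := diff2_sqrB p_pr p5 cardF m_gt1 dvd_m g_prim zeta_prim omega_half L_char0.
    have -> : 2 * c 2 ^+ 2 = (a 1)%:~R - (a 2)%:~R * (C 1%N)%:~R.
      have -> : (a 2)%:~R = - c 1 by rewrite diff1_value opprK.
      by rewrite -qE -h1 -jacobi_re_value mulNr opprK -h2; ring.
    rewrite -(aS (r := 1)) ?m_gt1 // rmorphXn /=; ring.
  have rm' : (1 < r <= m)%N by rewrite hr ltnW.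
  have [_ /(_ rm) h] := IH rm'.
  rewrite diff_double ?ltnS ?hr ?rm //= mulrBr mulrCA h mulrA -expr2 -rmorphXn /= aS ?m_gt1 //.
  by rewrite mulrBr; congr (_ - _); rewrite mulrC.
by split=> // rm'; apply: sign; rewrite ?r1.
Qed.

Lemma diff_im_values r : (1 < r <= m)%N ->
  (a r)%:~R * d r ^+ 2 = (a 1)%:~R * (D r)%:~R ^+ 2.
Proof.
move=> rm; have [e _] := diff_values rm.
have -> : d r ^+ 2 = (a 1)%:~R - c r ^+ 2 by rewrite -qE -(diff_sum rm); ring.
rewrite mulrBr e mulrC -mulrBr; congr (_ * _).
by rewrite rmorphD !rmorphXn /=; ring.
Qed.
End Solve.

(** * Real powers and the theorem *)

Lemma sumX_sign (L : comNzRingType) (B k : L) (n : nat) (e x : L) : (e == x) || (e == - x) ->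
  (B + k * e) ^+ n + (B - k * e) ^+ n = (B + k * x) ^+ n + (B - k * x) ^+ n.
Proof. by case/orP => /eqP -> //; rewrite mulrN opprK addrC. Qed.

Lemma prime_root_exists (L : numClosedFieldType) (p : nat) : prime p ->
  exists z : L, p.-primitive_root z.
Proof.
move=> pp; have p0 := prime_gt0 pp; have p1 := prime_gt1 pp.
pose P : {poly L} := \poly_(i < p) 1.
have sP : size P = p.
  by rewrite size_poly_eq // oner_eq0.
have [|z zP] := closed_rootP P _; first by rewrite sP gtn_eqF.
have zs : \sum_(i < p) z ^+ i = 0.
  by rewrite -[RHS](rootP zP) horner_poly; apply: eq_bigr => i _; rewrite mul1r.
have zp : z ^+ p = 1 by apply/eqP; rewrite -subr_eq0 subrX1 zs mulr0.
have [k kz kp] := prim_order_exists p0 zp.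
move/primeP: pp => [_ /(_ k kp)] /orP[/eqP k1|/eqP <-]; last by exists z.
have z1 : z = 1 by have := prim_expr_order kz; rewrite k1 expr1.
move: zs; rewrite z1 (eq_bigr (fun=> 1)) => [|i _]; last by rewrite expr1n.
by rewrite sumr_const card_ord => /eqP; rewrite pnatr_eq0 gtn_eqF.
Qed.

Section RealPowers.
Variables (R : realType) (p s : nat).
Hypothesis p_gt0 : (0 < p)%N.

Lemma qpow_pX x y : qpow R (p ^ s) x y = powR p%:R (s%:R * (x%:R / y%:R)).
Proof. by rewrite /qpow natrX -powR_mulrn ?ler0n // -powRrM. Qed.

Lemma powR_natD x y : powR (p%:R : R) x * powR p%:R y = powR p%:R (x + y).
Proof. by rewrite powRD // pnatr_eq0 -lt0n p_gt0 implybT. Qed.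

Lemma qpow_one : qpow R p s (2 ^ 0) = (p ^ s)%:R.
Proof. by rewrite /qpow expn0 divr1 powR_mulrn ?ler0n // natrX. Qed.

Lemma qpow_half_sqr r : qpow R p s (2 ^ r.+1) ^+ 2 = qpow R p s (2 ^ r).
Proof.
rewrite /qpow expr2 powR_natD !natrX; congr powR.
have : (2 ^+ r : R) != 0 by rewrite expf_neq0 ?pnatr_eq0.
by rewrite exprS; move: (_ ^+ r) => t t0; field; rewrite ?t0.
Qed.

Lemma qpow_sqrt : qpow R (p ^ s) 1 2 = qpow R p s (2 ^ 1).
Proof. by rewrite qpow_pX /qpow; congr powR; rewrite mul1r. Qed.

(** Twice the exponent is [1 - 1 / 2 ^ r.-1]. With [qpow_next], this identifies the real powers in
    the formula with the quotients of the [a r] that occur in the integral relations. *)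
Lemma qpow_sqr r : (0 < r)%N ->
  qpow R (p ^ s) (2 ^ r.-1 - 1) (2 ^ r) ^+ 2 * qpow R p s (2 ^ r.-1) = (p ^ s)%:R.
Proof.
case: r => // r _; rewrite qpow_pX /qpow expr2 !powR_natD [RHS]natrX -[RHS]powR_mulrn ?ler0n //.
congr powR; rewrite natrB ?expn_gt0 // !natrX exprS /=.
have : (2 ^+ r : R) != 0 by rewrite expf_neq0 ?pnatr_eq0.
by move: (_ ^+ r) => t t0; field; rewrite ?t0.
Qed.

Lemma qpow_next r : (0 < r)%N ->
  qpow R (p ^ s) (2 ^ r.-1 - 1) (2 ^ r) * qpow R p s (2 ^ r) = qpow R p s (2 ^ 1).
Proof.
case: r => // r _; rewrite qpow_pX /qpow powR_natD.
congr powR; rewrite natrB ?expn_gt0 // !natrX [2 ^+ r.+1]exprS expr1 /=.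
have : (2 ^+ r : R) != 0 by rewrite expf_neq0 ?pnatr_eq0.
by move: (_ ^+ r) => t t0; field; rewrite ?t0.
Qed.
End RealPowers.

Theorem theorem3 (R : realType) (F : finFieldType) (p s m n : nat)
  (C D : nat -> int) :
  prime p -> (p %% 8 = 5)%N -> (1 <= s)%N ->
  #|F| = (p ^ s)%N ->
  (2 <= m)%N -> (2 ^ m.+1 %| (p ^ s).-1)%N ->
  (1 <= n)%N ->
  (forall r, (1 <= r <= m)%N ->
     [/\ qpow R p s (2 ^ r.-1) = (C r)%:~R ^+ 2 + (D r)%:~R ^+ 2,
         (C r = -1 %[mod 4])%Z
       & ~~ (p%:Z %| C r)%Z]) ->
  let q := (p ^ s)%N in
  let Q : R := q%:R in
  let S t : R := \sum_(2 <= r < t.+1) 2 ^+ r.-1 * (C r)%:~R * qpow R q (2 ^ r.-1 - 1) (2 ^ r) in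
  (Nsol F n m)%:R =
    Q ^+ n.-1 + (Q - 1) / (2 ^+ m * Q) *
    ( 2 ^+ (m - 2) *
        ((qpow R q 1 2 + 2 * (D 2%N)%:~R * qpow R q 1 4) ^+ n
       + (qpow R q 1 2 - 2 * (D 2%N)%:~R * qpow R q 1 4) ^+ n)
    + \sum_(1 <= t < m.-1)
        2 ^+ (m - t - 2) *
        ((- qpow R q 1 2 + S t
            - 2 ^+ t * (C t.+1)%:~R * qpow R q (2 ^ t - 1) (2 ^ t.+1)
            + 2 ^+ t.+1 * (D t.+2)%:~R * qpow R q (2 ^ t.+1 - 1) (2 ^ t.+2)) ^+ n
       + (- qpow R q 1 2 + S t
            - 2 ^+ t * (C t.+1)%:~R * qpow R q (2 ^ t - 1) (2 ^ t.+1)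
            - 2 ^+ t.+1 * (D t.+2)%:~R * qpow R q (2 ^ t.+1 - 1) (2 ^ t.+2)) ^+ n)
    + (- qpow R q 1 2 + S m.-1
         - 2 ^+ m.-1 * (C m)%:~R * qpow R q (2 ^ m.-1 - 1) (2 ^ m)) ^+ n
    + (- qpow R q 1 2 + S m) ^+ n).
Proof.
move=> p_pr p8 s1 cardF m2 dvd_m n1 CD q Q S.
have p0 := prime_gt0 p_pr.
have [g g_prim] := finField_primitive_root F.
(* The complex field supplies both roots of unity; the formula is established there and pulled back
   along the injective [iota]. *)
pose L := complex R; pose iota : {rmorphism R -> L} := real_complex R.
have [zeta zeta_prim] := prime_root_exists L p_pr.
have [omega omega_half] : exists w : L, w ^+ (2 ^ m.-1) = -1.
  by exists ((2 ^ m.-1).-root (-1)); rewrite rootCK ?expn_gt0.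
have L0 : [pchar L] =i pred0 by apply: pchar_num.
rewrite -cardF in dvd_m.
have dvd_mN : (2 ^ m %| #|F|.-1)%N by rewrite (dvdn_trans _ dvd_m) // dvdn_exp2l.
pose a r : int := C r ^+ 2 + D r ^+ 2.
have aE r : (0 < r <= m)%N -> qpow R p s (2 ^ r.-1) = (a r)%:~R.
  by move=> /CD[-> _ _]; rewrite rmorphD !rmorphXn.
have m1 : (0 < m)%N := ltnW m2.
have a1 : a 1%N = (p ^ s)%:Z.
  by apply/eqP; rewrite -(eqr_int R) -aE //= qpow_one pmulrn.
have aS r : (0 < r < m)%N -> a r.+1 ^+ 2 = a r.
  case/andP=> r0 rm; apply/eqP; rewrite -(eqr_int R) rmorphXn /= -!aE ?r0 ?(ltnW rm) //=.
  by case: r r0 rm => // r _ _; rewrite qpow_half_sqr.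
have C4 r : (0 < r <= m)%N -> (C r = -1 %[mod 4])%Z by case/CD.
have Cp r : (0 < r <= m)%N -> ~~ (p%:Z %| C r)%Z by case/CD.
pose qr r : R := qpow R q (2 ^ r.-1 - 1) (2 ^ r).
have half : qpow R q 1 2 = (a 2%N)%:~R by rewrite qpow_sqrt //; exact: (aE 2%N).
have qr_sqr r : (0 < r <= m)%N -> qr r ^+ 2 * (a r)%:~R = (a 1%N)%:~R.
  by case/andP=> r0 rm; rewrite -!aE ?r0 //= qpow_one qpow_sqr.
have qr_next r : (0 < r < m)%N -> qr r * (a r.+1)%:~R = (a 2%N)%:~R.
  by case/andP=> r0 rm; rewrite -!aE //= qpow_next.
have a0 r : (0 < r <= m)%N -> (a r)%:~R != 0 :> L.
  move=> rm; have [y ey] := tower_mod4 p_pr p8 s1 a1 aS C4 rm.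
  by rewrite intr_eq0 /a ey; clear; lia.
have iotaZ (z : int) : iota z%:~R = z%:~R by apply: rmorph_int.
set f := gen_char p s zeta g; set N := #|F|.-1.
have c1 : period_diff f N 1 0 = iota (- qpow R q 1 2).
  rewrite (diff1_value p_pr p8 cardF m2 dvd_m g_prim zeta_prim L0 a1 aS C4).
  by rewrite half rmorphN iotaZ.
have dv r : (1 < r <= m)%N ->
    (a r)%:~R * period_diff f N r 0 ^+ 2 = (a 1%N)%:~R * (C r)%:~R ^+ 2 /\
    ((r < m)%N -> (a r.+1)%:~R * period_diff f N r 0 = (a 2%N)%:~R * (C r)%:~R).
  exact: (diff_values p_pr p8 cardF m2 dvd_m g_prim zeta_prim omega_half L0 a1 aS C4 Cp).
have di r : (1 < r <= m)%N ->
    (a r)%:~R * period_diff f N r (2 ^ r.-2) ^+ 2 = (a 1%N)%:~R * (D r)%:~R ^+ 2.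
  exact: (diff_im_values p_pr p8 cardF m2 dvd_m g_prim zeta_prim omega_half L0 a1 aS C4 Cp).
have cE r : (1 < r < m)%N -> period_diff f N r 0 = iota ((C r)%:~R * qr r).
  case/andP=> r1 rm; have [|_ /(_ rm) h] := dv r; first by rewrite r1 ltnW.
  apply: (mulfI (a0 r.+1 rm)); rewrite h -!iotaZ -[LHS]rmorphM -[RHS]rmorphM; congr (iota _).
  by rewrite -(qr_next r) ?(ltnW r1) //; ring.
have sqrE (x : L) (y : int) r : (1 < r <= m)%N ->
    (a r)%:~R * x ^+ 2 = (a 1%N)%:~R * y%:~R ^+ 2 ->
    (x == iota (y%:~R * qr r)) || (x == - iota (y%:~R * qr r)).
  case/andP=> r1 rm h; rewrite -eqf_sqr; apply/eqP.
  have rm0 : (0 < r <= m)%N by rewrite rm ltnW.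
  apply: (mulfI (a0 r rm0)); rewrite h -!iotaZ -[iota y%:~R ^+ 2]rmorphXn -[iota (_ * _) ^+ 2]rmorphXn.
  rewrite -[LHS]rmorphM -[RHS]rmorphM; congr (iota _).
  by rewrite -(qr_sqr r rm0); ring.
have lowE t : (0 < t < m)%N -> low_sum f N t = iota (- qpow R q 1 2 + S t).
  case/andP=> t0 tm; rewrite /low_sum big_ltn // expr0 mul1r c1 rmorphD; congr (_ + _).
  rewrite rmorph_sum; apply: eq_big_nat => r /andP[r2 rt].
  rewrite cE ?r2 ?(leq_ltn_trans _ tm) //.
  by rewrite -mulrA [RHS]rmorphM rmorphXn rmorph_nat.
have key := Nsol_power_sum p_pr cardF dvd_m g_prim zeta_prim n.
have N0 := prim_order_gt0 g_prim.
rewrite (sum_power_sumX N0 (gen_char_periodic p s g_prim zeta) dvd_mN p8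
  (coprime_p_N p_pr cardF) (gen_char_frob cardF g zeta)
  (gen_char_sum p_pr cardF g_prim zeta_prim) n m2) in key.
set T : R := (X in _ / _ * X).
have TE : iota T = \sum_(0 <= t < m.-1) 2 ^+ (m - t - 2) *
    ((low_sum f N t - 2 ^+ t * period_diff f N t.+1 0
        + 2 ^+ t.+1 * period_diff f N t.+2 (2 ^ t)) ^+ n
   + (low_sum f N t - 2 ^+ t * period_diff f N t.+1 0
        - 2 ^+ t.+1 * period_diff f N t.+2 (2 ^ t)) ^+ n)
  + (low_sum f N m.-1 - 2 ^+ m.-1 * period_diff f N m 0) ^+ n + low_sum f N m ^+ n.
  (* The last two terms are powers of [low_sum f N m.-1] plus and minus the same quantity, so [c m]
     is needed only up to sign; correcting the sign may exchange them. *)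
  have lowm : low_sum f N m = low_sum f N m.-1 + 2 ^+ m.-1 * period_diff f N m 0.
    by rewrite /low_sum -{1}(prednK m1) big_nat_recr //= prednK.
  have mm : (0 < m.-1 < m)%N by case: (m) m2 => [|[|]] //= k _; rewrite ltnS.
  have Sm : S m = S m.-1 + 2 ^+ m.-1 * ((C m)%:~R * qr m).
    rewrite /S -{1}(prednK m1) big_nat_recr //=; last by rewrite prednK.
    by rewrite prednK // mulrA.
  have i2 k x : iota (2 ^+ k * x) = 2 ^+ k * iota x.
    by rewrite rmorphM rmorphXn rmorph_nat.
  rewrite -[RHS]addrA [X in _ = _ + X]addrC lowm.
  rewrite (sumX_sign _ _ _ (sqrE _ _ m _ (proj1 (dv m _)))) ?m2 ?leqnn //.
  rewrite lowE // big_ltn; last by case/andP: mm.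
  rewrite /T !rmorphD /= -[LHS]addrA -[LHS]addrA -[RHS]addrA; congr (_ + (_ + _)).
  - rewrite subn0 rmorphM rmorphXn rmorph_nat; congr (_ * _).
    (* For [t = 0] the low sum is empty and [- c 1] is plus the square root of [q], which is why
       this pair stands apart in the formula. *)
    rewrite /low_sum big_geq // sub0r expr0 mul1r c1 rmorphN opprK expr1.
    rewrite (sumX_sign _ _ _ (sqrE _ _ 2%N _ (di 2%N _))) //.
    rewrite rmorphD !rmorphXn; congr (_ ^+ n + _ ^+ n).
      by rewrite rmorphD -mulrA [iota (2 * _)]rmorphM rmorph_nat.
    by rewrite rmorphB -mulrA [iota (2 * _)]rmorphM rmorph_nat.
  - rewrite rmorph_sum; apply: eq_big_nat => t /andP[t1 tm].
    have t2m : (t.+2 <= m)%N by lia.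
    rewrite rmorphM rmorphXn rmorph_nat; congr (_ * _).
    rewrite (sumX_sign _ _ _ (sqrE _ _ t.+2 _ (di t.+2 _))) //.
    rewrite lowE ?t1 ?(ltnW t2m) // cE ?ltnS ?t1 // -!mulrA.
    rewrite rmorphD !rmorphXn; congr (_ ^+ n + _ ^+ n).
      by rewrite rmorphD rmorphB !i2.
    by rewrite !rmorphB !i2.
  - rewrite addrC; congr (_ + _); rewrite rmorphXn; congr (_ ^+ n).
      by rewrite Sm addrA rmorphD i2 rmorphD.
    by rewrite -mulrA rmorphB i2 rmorphD.
rewrite -TE in key.
have two0 : (2 ^+ m : R) != 0 by rewrite expf_neq0 ?pnatr_eq0.
have q0 : Q != 0 by rewrite pnatr_eq0 expn_eq0 -leqn0 leqNgt p0.
have NE : (N %/ 2 ^ m)%:R = (Q - 1) / 2 ^+ m :> R.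
  apply: (mulIf two0); rewrite divfK // -natrX -natrM divnK // /N cardF /Q /q.
  by rewrite -subn1 natrB // expn_gt0 p0.
have keyR : (Nsol F n m)%:R * Q = Q ^+ n + (Q - 1) / 2 ^+ m * T.
  apply: (fmorph_inj iota); rewrite -NE.
  by rewrite rmorphD !rmorphM rmorphXn /Q !rmorph_nat /q -cardF; exact: key.
apply: (mulIf q0); rewrite keyR [RHS]mulrDl -exprSr prednK //; congr (_ + _).
by field; rewrite q0.
Qed.
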